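(* Let $k\ge1$ and let $L_n^{(j)}=\mathrm{LScirc}(l_0^{(j)},l_1^{(j)},\dots,l_{n-1}^{(j)})$, $1\le j\le k$, be independent left skew-circulant random matrices whose input sequences $\{l_i^{(j)}\}_{i\ge0}$ consist of independent real random variables with mean $0$, variance $1$ and uniformly bounded moments of every order. Then $\{n^{-1/2}L_n^{(j)}\}_{1\le j\le k}$, as elements of $(\mathcal{M}_n,\varphi_n=n^{-1}\mathbb{E}\,\mathrm{Tr})$, converge jointly in $*$-distribution to half-independent (self-adjoint) variables, each having the symmetrized Rayleigh distribution with unit variance.
   Context: The left skew-circulant matrix $\mathrm{LScirc}(l_0,\dots,l_{n-1})$ has $(i,j)$ entry ($0\le i,j\le n-1$) equal to $l_{i+j}$ if $i+j\le n-1$ and $-l_{i+j-n}$ if $i+j\ge n$. An NCP (non-commutative $*$-probability space) $(\mathcal{A},\varphi)$ is a unital complex $*$-algebra with a complex linear functional $\varphi$ satisfying $\varphi(1_{\mathcal{A}})=1$. $\mathbb{C}\langle x_1,\dots,x_p\rangle$ denotes the set of complex monomials in the non-commuting indeterminates $x_1,x_1^*,\dots,x_p,x_p^*$. Elements $\{a_{n,j}\}_{1\le j\le p}$ of NCPs $(\mathcal{A}_n,\varphi_n)$ converge (jointly) in $*$-distribution to $\{a_j\}_{1\le j\le p}\subset\mathcal{A}$ if $\lim_n\varphi_n(Q(\{a_{n,j}\}))=\varphi(Q(\{a_j\}))$ for all $Q\in\mathbb{C}\langle x_1,\dots,x_p\rangle$. $\mathcal{M}_n$ is the $*$-algebra of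 $n\times n$ random matrices all of whose entries have finite moments of all orders. A self-adjoint variable $a$ ($a=a^*$) is a standard symmetrized Rayleigh variable (unit variance) if $\varphi(a^{2m-1})=0$ and $\varphi(a^{2m})=m!$ for all $m\ge1$. Variables $\{a_j\}_{j\in\mathcal{J}}$ half-commute if $a_ia_ja_k=a_ka_ja_i$ for all $i,j,k\in\mathcal{J}$. A monomial $a_{j_1}\cdots a_{j_r}$ is symmetric if for each $j$ the number of appearances of $a_j$ at odd positions equals the number at even positions; otherwise it is non-symmetric. Half-commuting variables $\{a_j\}$ are half-independent if $\{a_j^2\}$ are independent (they commute and their joint moments factor into products of individual moments) and $\varphi(Q)=0$ for every non-symmetric monomial $Q$ in $\{a_j\}$. *)

(* Defs.v *)
From HB Require Import structures.
From mathcomp Require Import all_boot all_order all_algebra.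
From mathcomp Require Export finmap.
From mathcomp Require Export all_classical all_reals all_analysis.
From mathcomp Require Export measurable_realfun complex.

Set Implicit Arguments.
Unset Strict Implicit.
Unset Printing Implicit Defensive.

Import Order.TTheory GRing.Theory Num.Theory.
Import numFieldNormedType.Exports.

Local Open Scope classical_set_scope.
Local Open Scope ring_scope.
Local Open Scope complex_scope.

(* Algebras are over a numClosedFieldType C, used at C = R[i] with R : realType;
   at R[i] the conjugation Num.conj is complex conjugation. *)
HB.mixin Record Algebra_isStarAlgebra (C : numClosedFieldType) A
    of GRing.Algebra C A := {
  star : A -> A;
  starK : involutive star;
  starD : {morph star : x y / x + y};
  starZ : forall (c : C) (x : A), star (c *: x) = Num.conj c *: star x;
  starM : forall x y : A, star (x * y) = star y * star x
}.

#[short(type="starAlgType")]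
HB.structure Definition StarAlgebra (C : numClosedFieldType) :=
  {A of GRing.Algebra C A & Algebra_isStarAlgebra C A}.

Record ncp (C : numClosedFieldType) := Ncp {
  ncp_alg :> starAlgType C;
  ncp_state : {scalar ncp_alg};
  ncp_state1 : ncp_state 1 = 1
}.

Section noncommutative_probability.
Variable C : numClosedFieldType.

(* A monomial c x_(j1)^e1 ... x_(jr)^er: the letter (j, false) stands for x_j
   and (j, true) for its adjoint. *)
Definition star_monomial (p : nat) : Type := (C * seq ('I_p * bool))%type.

Definition eval_star_monomial (A : starAlgType C) p (a : 'I_p -> A)
    (Q : star_monomial p) : A :=
  Q.1 *: \prod_(x <- Q.2) (if x.2 then star (a x.1) else a x.1).

Definition converges_in_star_distribution p (An : nat -> ncp C)
    (an : forall n, 'I_p -> An n) (A : ncp C) (a : 'I_p -> A) : Prop :=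
  forall Q : star_monomial p,
    ncp_state (An n) (eval_star_monomial (an n) Q) @[n --> \oo]
      --> ncp_state A (eval_star_monomial a Q).

Variable A : ncp C.

Definition standard_symmetrized_rayleigh (a : A) : Prop :=
  star a = a /\
  forall m, (0 < m)%N ->
    ncp_state A (a ^+ (2 * m).-1) = 0 /\ ncp_state A (a ^+ (2 * m)) = (m`!)%:R.

Variable p : nat.
Implicit Type a : 'I_p -> A.

Definition half_commute a : Prop :=
  forall i j k, a i * a j * a k = a k * a j * a i.

(* The words below are read from position 1, so that the letter of index t
   (counted from 0) sits at an odd position iff t is even. *)
Definition occurrences_at (odd_position : bool) (s : seq 'I_p) (j : 'I_p) : nat :=
  #|[pred t : 'I_(size s) |
      (odd t.+1 == odd_position) && (tnth (in_tuple s) t == j)]|.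

Definition symmetric_word (s : seq 'I_p) : Prop :=
  forall j, occurrences_at true s j = occurrences_at false s j.

Definition classically_independent (b : 'I_p -> A) : Prop :=
  (forall i j, b i * b j = b j * b i) /\
  forall m : 'I_p -> nat,
    ncp_state A (\prod_(j < p) b j ^+ m j) =
    \prod_(j < p) ncp_state A (b j ^+ m j).

Definition half_independent a : Prop :=
  [/\ half_commute a,
      classically_independent (fun j => a j ^+ 2) &
      forall s : seq 'I_p, ~ symmetric_word s ->
        ncp_state A (\prod_(j <- s) a j) = 0].

End noncommutative_probability.

Section independence.
Context d (T : measurableType d) (R : realType) (P : probability T R).

Definition independent_set_systems (I : choiceType) (F : I -> set_system T) :
    Prop :=
  forall (J : {fset I}) (E : I -> set T),
    (forall i, i \in J -> F i (E i)) ->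
    P (\bigcap_(i in [set` J]) E i) = (\prod_(i <- J) P (E i))%E.

Definition independent_RVs (I : choiceType) (X : I -> T -> R) : Prop :=
  independent_set_systems (fun i => g_sigma_algebra_preimage (X i)).

Definition sigma_random_matrix n (M : T -> 'M[R]_n) : set_system T :=
  <<s \bigcup_(ij in [set: 'I_n * 'I_n])
        g_sigma_algebra_preimage (fun w => M w ij.1 ij.2) >>.

Definition independent_random_matrices (I : choiceType) n
    (M : I -> T -> 'M[R]_n) : Prop :=
  independent_set_systems (fun i => sigma_random_matrix (M i)).

Definition uniformly_bounded_moments (I : Type) (X : I -> T -> R) : Prop :=
  forall m : nat, exists B : R,
    forall i, ('E_P[(fun w => `|X i w| ^+ m)%R] <= B%:E)%E.

End independence.

Definition lscirc (V : zmodType) (n : nat) (l : nat -> V) : 'M[V]_n :=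
  \matrix_(i, j) if (i + j < n)%N then l (i + j)%N else - l (i + j - n)%N.

Section complex_random_variables.
Context d (T : measurableType d) (R : realType) (P : probability T R).
Local Notation C := R[i].
Implicit Types X Y : T -> C.

Definition finite_moments X : Prop :=
  [/\ measurable_fun setT (fun w => complex.Re (X w)),
      measurable_fun setT (fun w => complex.Im (X w)) &
      forall m : nat, ('E_P[(fun w => Normc.normc (X w) ^+ m)%R] < +oo)%E].

Definition cexpectation X : C :=
  fine 'E_P[fun w => complex.Re (X w)] +i* fine 'E_P[fun w => complex.Im (X w)].

Lemma normc_ge0 (x : C) : 0 <= Normc.normc x.
Proof. by case: x => a b /=; rewrite sqrtr_ge0. Qed.

Lemma measurable_normc X :
  measurable_fun setT (fun w => complex.Re (X w)) ->
  measurable_fun setT (fun w => complex.Im (X w)) ->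
  measurable_fun setT (fun w => Normc.normc (X w)).
Proof.
move=> mr mi.
rewrite (_ : (fun w => _) =
  Num.sqrt \o (fun w => complex.Re (X w) ^+ 2 + complex.Im (X w) ^+ 2)).
  apply: measurableT_comp; first exact: continuous_measurable_fun (@sqrt_continuous R).
  by apply: measurable_funD; exact: measurable_funX.
by apply/funext => w /=; case: (X w).
Qed.

Lemma dominated_expectation (f g h : T -> R) (c : R) :
  measurable_fun setT f -> measurable_fun setT g -> measurable_fun setT h ->
  (forall w, 0 <= f w) -> (forall w, 0 <= g w) -> (forall w, 0 <= h w) ->
  0 <= c -> (forall w, f w <= c * (g w + h w)) ->
  ('E_P[g] < +oo)%E -> ('E_P[h] < +oo)%E -> ('E_P[f] < +oo)%E.
Proof.
move=> /measurable_EFinP mf /measurable_EFinP mg /measurable_EFinP mh f0 g0 h0.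
move=> c0 le_f; rewrite unlock => Eg Eh.
have mgh : measurable_fun setT (fun w => (g w)%:E + (h w)%:E)%E.
  exact: emeasurable_funD.
have mcgh : measurable_fun setT (fun w => c%:E * ((g w)%:E + (h w)%:E))%E.
  exact: measurable_funeM.
apply: (@le_lt_trans _ _ (\int[P]_w (c%:E * ((g w)%:E + (h w)%:E)))%E).
  by apply: ge0_le_integral => // w _; rewrite ?lee_fin.
rewrite ge0_integralZl//; last by move=> w _; rewrite -EFinD lee_fin addr_ge0.
rewrite ge0_integralD//; [|by move=> w _; rewrite lee_fin..].
by apply: lte_mul_pinfty => //; rewrite ?lee_fin// lte_add_pinfty.
Qed.

Lemma finite_moments_cst (c : C) : finite_moments (fun=> c).
Proof.
split; [exact: measurable_cst|exact: measurable_cst|move=> m].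
by rewrite (expectation_cst P (Normc.normc c ^+ m)) ltry.
Qed.

Lemma finite_momentsD X Y :
  finite_moments X -> finite_moments Y -> finite_moments (fun w => X w + Y w).
Proof.
move=> [mXr mXi EX] [mYr mYi EY].
have mr : measurable_fun setT (fun w => complex.Re (X w + Y w)).
  rewrite (_ : (fun w => _) = (fun w => complex.Re (X w) + complex.Re (Y w))).
    exact: measurable_funD.
  by apply/funext => w; case: (X w) (Y w) => [? ?] [? ?].
have mi : measurable_fun setT (fun w => complex.Im (X w + Y w)).
  rewrite (_ : (fun w => _) = (fun w => complex.Im (X w) + complex.Im (Y w))).
    exact: measurable_funD.
  by apply/funext => w; case: (X w) (Y w) => [? ?] [? ?].
split=> // m.
apply: (@dominated_expectation _ (fun w => Normc.normc (X w) ^+ m)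
          (fun w => Normc.normc (Y w) ^+ m) (2 ^+ m)) => //.
- exact/measurable_funX/measurable_normc.
- exact/measurable_funX/measurable_normc.
- exact/measurable_funX/measurable_normc.
- by move=> w; rewrite exprn_ge0// normc_ge0.
- by move=> w; rewrite exprn_ge0// normc_ge0.
- by move=> w; rewrite exprn_ge0// normc_ge0.
- move=> w; have x0 := normc_ge0 (X w); have y0 := normc_ge0 (Y w).
  have le0 := normc_ge0 (X w + Y w).
  apply: (@le_trans _ _ ((Normc.normc (X w) + Normc.normc (Y w)) ^+ m)).
    by rewrite lerXn2r ?nnegrE ?addr_ge0//; exact: le_normcD.
  have [xy|yx] := leP (Normc.normc (X w)) (Normc.normc (Y w)).
    apply: (@le_trans _ _ ((2 * Normc.normc (Y w)) ^+ m)).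
      by rewrite lerXn2r ?nnegrE ?addr_ge0 ?mulr_ge0// mulr2n mulrDl mul1r lerD2r.
    by rewrite exprMn ler_wpM2l// lerDr exprn_ge0.
  apply: (@le_trans _ _ ((2 * Normc.normc (X w)) ^+ m)).
    by rewrite lerXn2r ?nnegrE ?addr_ge0 ?mulr_ge0// mulr2n mulrDl mul1r lerD2l ltW.
  by rewrite exprMn ler_wpM2l// lerDl exprn_ge0.
Qed.

Lemma finite_momentsM X Y :
  finite_moments X -> finite_moments Y -> finite_moments (fun w => X w * Y w).
Proof.
move=> [mXr mXi EX] [mYr mYi EY].
have mr : measurable_fun setT (fun w => complex.Re (X w * Y w)).
  rewrite (_ : (fun w => _) = (fun w => complex.Re (X w) * complex.Re (Y w)
                                 - complex.Im (X w) * complex.Im (Y w))).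
    by apply: measurable_funB; exact: measurable_funM.
  by apply/funext => w; case: (X w) (Y w) => [? ?] [? ?].
have mi : measurable_fun setT (fun w => complex.Im (X w * Y w)).
  rewrite (_ : (fun w => _) = (fun w => complex.Re (X w) * complex.Im (Y w)
                                 + complex.Im (X w) * complex.Re (Y w))).
    by apply: measurable_funD; exact: measurable_funM.
  by apply/funext => w; case: (X w) (Y w) => [? ?] [? ?].
split=> // m.
apply: (@dominated_expectation _ (fun w => Normc.normc (X w) ^+ (m * 2))
          (fun w => Normc.normc (Y w) ^+ (m * 2)) 1) => //.
- exact/measurable_funX/measurable_normc.
- exact/measurable_funX/measurable_normc.
- exact/measurable_funX/measurable_normc.
- by move=> w; rewrite exprn_ge0// normc_ge0.
- by move=> w; rewrite exprn_ge0// normc_ge0.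
- by move=> w; rewrite exprn_ge0// normc_ge0.
- move=> w; rewrite mul1r Normc.normcM exprMn !exprM.
  set x := _ ^+ m; set y := _ ^+ m.
  have x0 : 0 <= x by rewrite exprn_ge0// normc_ge0.
  have y0 : 0 <= y by rewrite exprn_ge0// normc_ge0.
  have [xy|yx] := leP x y.
    by apply: (@le_trans _ _ (y ^+ 2)); rewrite ?lerDr ?sqr_ge0// expr2 ler_wpM2r.
  by apply: (@le_trans _ _ (x ^+ 2));
    rewrite ?lerDl ?sqr_ge0// expr2 ler_wpM2l// ltW.
Qed.

Lemma finite_moments_conj X :
  finite_moments X -> finite_moments (fun w => Num.conj (X w)).
Proof.
move=> [mr mi EX]; split.
- rewrite (_ : (fun w => _) = (fun w => complex.Re (X w)))//.
  by apply/funext => w; case: (X w).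
- rewrite (_ : (fun w => _) = (fun w => - complex.Im (X w))).
    exact: measurableT_comp.
  by apply/funext => w; case: (X w).
- move=> m; rewrite (_ : (fun w => _) = (fun w => Normc.normc (X w) ^+ m))//.
  by apply/funext => w; case: (X w) => a b /=; rewrite sqrrN.
Qed.

Lemma finite_moments_sum (I : Type) (r : seq I) (F : I -> T -> C) :
  (forall i, finite_moments (F i)) ->
  finite_moments (fun w => \sum_(i <- r) F i w).
Proof.
move=> HF; elim: r => [|i r IHr].
  under eq_fun do rewrite big_nil.
  exact: finite_moments_cst.
by under eq_fun do rewrite big_cons; exact: finite_momentsD.
Qed.

Lemma finite_moments_Lfun X : finite_moments X ->
  (fun w => complex.Re (X w)) \in Lfun P 1 /\
  (fun w => complex.Im (X w)) \in Lfun P 1.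
Proof.
move=> [mr mi /(_ 1%N)]; rewrite unlock => EX.
have mn := measurable_normc mr mi.
have iN : P.-integrable setT (fun w => (Normc.normc (X w))%:E).
  apply/integrableP; split; first exact/measurable_EFinP.
  apply: le_lt_trans EX; apply: ge0_le_integral => //.
  - exact/measurableT_comp/measurable_EFinP.
  - exact/measurable_EFinP.
  - by move=> w _; rewrite expr1 gee0_abs// lee_fin normc_ge0.
split; apply/Lfun1_integrable; apply: (le_integrable _ _ _ iN) => //.
- exact/measurable_EFinP.
- move=> w _; rewrite /= lee_fin (ger0_norm (normc_ge0 _)).
  case: (X w) => a b /=; rewrite -sqrtr_sqr ler_sqrt ?addr_ge0 ?sqr_ge0//.
  by rewrite lerDl sqr_ge0.
- exact/measurable_EFinP.
- move=> w _; rewrite /= lee_fin (ger0_norm (normc_ge0 _)).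
  case: (X w) => a b /=; rewrite -sqrtr_sqr ler_sqrt ?addr_ge0 ?sqr_ge0//.
  by rewrite lerDr sqr_ge0.
Qed.

Lemma cexpectation_cst (c : C) : cexpectation (fun=> c) = c.
Proof.
rewrite /cexpectation (expectation_cst P (complex.Re c)).
by rewrite (expectation_cst P (complex.Im c)) /=; case: c.
Qed.

Lemma cexpectationD X Y : finite_moments X -> finite_moments Y ->
  cexpectation (fun w => X w + Y w) = cexpectation X + cexpectation Y.
Proof.
move=> /finite_moments_Lfun[Xr Xi] /finite_moments_Lfun[Yr Yi].
rewrite /cexpectation.
rewrite (_ : (fun w => complex.Re (X w + Y w)) =
             (fun w => complex.Re (X w)) \+ (fun w => complex.Re (Y w))); last first.
  by apply/funext => w /=; case: (X w) (Y w) => [? ?] [? ?].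
rewrite (_ : (fun w => complex.Im (X w + Y w)) =
             (fun w => complex.Im (X w)) \+ (fun w => complex.Im (Y w))); last first.
  by apply/funext => w /=; case: (X w) (Y w) => [? ?] [? ?].
rewrite !expectationD// !fineD//; exact: expectation_fin_num.
Qed.

Lemma cexpectationZ (c : C) X : finite_moments X ->
  cexpectation (fun w => c * X w) = c * cexpectation X.
Proof.
move=> /finite_moments_Lfun[Xr Xi]; case: c => a b; rewrite /cexpectation.
have LZ (u : R) (f : T -> R) : f \in Lfun P 1 -> (u \o* f) \in Lfun P 1.
  by move=> fL; rewrite (_ : u \o* f = u *: f) ?rpredZ//;
    apply/funext => w /=; rewrite mulrC.
rewrite (_ : (fun w => complex.Re ((a +i* b) * X w)) =
             (a \o* (fun w => complex.Re (X w))) \+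
             ((- b) \o* (fun w => complex.Im (X w)))); last first.
  by apply/funext => w /=; case: (X w) => u v /=; rewrite mulrN [a * _]mulrC [b * _]mulrC.
rewrite (_ : (fun w => complex.Im ((a +i* b) * X w)) =
             (a \o* (fun w => complex.Im (X w))) \+
             (b \o* (fun w => complex.Re (X w)))); last first.
  by apply/funext => w /=; case: (X w) => u v /=; rewrite [a * _]mulrC [b * _]mulrC.
rewrite !expectationD ?LZ// !expectationZl//.
rewrite !fineD ?fin_numM ?expectation_fin_num// !fineM ?expectation_fin_num//=.
by rewrite mulNr.
Qed.

End complex_random_variables.

Section function_algebra.
Variables (T : pointedType) (K : pzRingType) (A : algType K).

Let scalerAl_fct (c : K) (f g : T -> A) : c *: (f * g) = c *: f * g.
Proof. by apply/funext => x; exact: scalerAl. Qed.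
HB.instance Definition _ :=
  GRing.Lmodule_isLalgebra.Build K (T -> A) scalerAl_fct.

Let scalerAr_fct (c : K) (f g : T -> A) : c *: (f * g) = f * (c *: g).
Proof. by apply/funext => x; exact: scalerAr. Qed.
HB.instance Definition _ :=
  GRing.Lalgebra_isAlgebra.Build K (T -> A) scalerAr_fct.

End function_algebra.

(* The size is n.+1 because 'M_0 is the zero ring, which carries no functional
   with phi 1 = 1. *)
Section random_matrices.
Context d (T : measurableType d) (R : realType) (P : probability T R) (n : nat).
Local Notation C := R[i].

Definition random_matrix_pred : {pred T -> 'M[C]_n.+1} :=
  fun M => `[< forall i j, finite_moments P (fun w => M w i j) >].

Record random_matrix := RandomMatrix {
  random_matrix_val :> T -> 'M[C]_n.+1;
  _ : random_matrix_val \in random_matrix_pred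
}.

HB.instance Definition _ := [isSub for random_matrix_val].
HB.instance Definition _ := [Choice of random_matrix by <:].

Lemma random_matrix_closed : GRing.subsemialg_closed random_matrix_pred.
Proof.
split.
- apply/asboolP => i j; rewrite (_ : (fun w => _) = fun=> (i == j)%:R).
    exact: finite_moments_cst.
  by apply/funext => w; rewrite mxE.
- split.
    apply/asboolP => i j; rewrite (_ : (fun w => _) = fun=> 0).
      exact: finite_moments_cst.
    by apply/funext => w; rewrite mxE.
  move=> M N /asboolP HM /asboolP HN; apply/asboolP => i j.
  rewrite (_ : (fun w => _) = fun w => M w i j + N w i j); last first.
    by apply/funext => w; rewrite mxE.
  exact: finite_momentsD.
- move=> c M /asboolP HM; apply/asboolP => i j.
  rewrite (_ : (fun w => _) = fun w => c * M w i j); last first.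
    by apply/funext => w; rewrite mxE.
  by apply: finite_momentsM; first exact: finite_moments_cst.
- move=> M N /asboolP HM /asboolP HN; apply/asboolP => i j.
  rewrite (_ : (fun w => _) = fun w => \sum_k M w i k * N w k j); last first.
    by apply/funext => w; rewrite mxE.
  by apply: finite_moments_sum => k; exact: finite_momentsM.
Qed.

HB.instance Definition _ :=
  GRing.SubChoice_isSubAlgebra.Build C (T -> 'M[C]_n.+1) random_matrix_pred
    random_matrix random_matrix_closed.

Lemma random_matrix_moments (M : random_matrix) i j :
  finite_moments P (fun w => M w i j).
Proof. by have /asboolP := valP M. Qed.

Lemma adjoint_random_matrix_subproof (M : random_matrix) :
  (fun w => (map_mx Num.conj (M w))^T) \in random_matrix_pred.
Proof.
apply/asboolP => i j.
rewrite (_ : (fun w => _) = fun w => Num.conj (M w j i)); last first.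
  by apply/funext => w; rewrite !mxE.
exact/finite_moments_conj/random_matrix_moments.
Qed.

Definition adjoint_random_matrix (M : random_matrix) : random_matrix :=
  RandomMatrix (adjoint_random_matrix_subproof M).

Let adjointK : involutive adjoint_random_matrix.
Proof.
by move=> M; apply/val_inj/funext => w /=; apply/matrixP => i j; rewrite !mxE conjCK.
Qed.

Let adjointD : {morph adjoint_random_matrix : M N / M + N}.
Proof.
move=> M N; apply/val_inj/funext => w; apply/matrixP => i j.
by rewrite !mxE rmorphD.
Qed.

Let adjointZ (c : C) (M : random_matrix) :
  adjoint_random_matrix (c *: M) = Num.conj c *: adjoint_random_matrix M.
Proof.
apply/val_inj/funext => w; apply/matrixP => i j.
by rewrite !mxE rmorphM.
Qed.

Let adjointM (M N : random_matrix) :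
  adjoint_random_matrix (M * N) =
  adjoint_random_matrix N * adjoint_random_matrix M.
Proof.
apply/val_inj/funext => w; apply/matrixP => i j.
rewrite !mxE rmorph_sum; apply: eq_bigr => k _.
by rewrite !mxE rmorphM mulrC.
Qed.

HB.instance Definition _ := Algebra_isStarAlgebra.Build C random_matrix
  adjointK adjointD adjointZ adjointM.

Definition mean_normalized_trace (M : random_matrix) : C :=
  n.+1%:R^-1 * cexpectation P (fun w => \tr (M w)).

Let mean_normalized_trace_scalar : scalar mean_normalized_trace.
Proof.
have trf (M : random_matrix) : finite_moments P (fun w => \tr (M w)).
  by apply: finite_moments_sum => i; exact: random_matrix_moments.
move=> c M N; rewrite /mean_normalized_trace.
rewrite (_ : (fun w => \tr _) = fun w => c * \tr (M w) + \tr (N w)); last first.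
  by apply/funext => w; rewrite -mxtraceZ -mxtraceD.
rewrite cexpectationD//; last first.
  by apply: finite_momentsM => //; exact: finite_moments_cst.
by rewrite cexpectationZ// mulrDr mulrCA.
Qed.

HB.instance Definition _ := GRing.isLinear.Build C random_matrix C *%R
  mean_normalized_trace mean_normalized_trace_scalar.

Let mean_normalized_trace1 : mean_normalized_trace 1 = 1.
Proof.
rewrite /mean_normalized_trace.
rewrite (_ : (fun w => \tr _) = fun=> n.+1%:R); last first.
  by apply/funext => w; exact: mxtrace1.
by rewrite cexpectation_cst mulVf// pnatr_eq0.
Qed.

Definition random_matrix_ncp : ncp C :=
  @Ncp C random_matrix mean_normalized_trace mean_normalized_trace1.

End random_matrices.

Section random_left_skew_circulant.
Context d (T : measurableType d) (R : realType) (P : probability T R).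
Variable l : nat -> {RV P >-> R}.

Definition random_lscirc (n : nat) : T -> 'M[R]_n :=
  fun w => lscirc n (fun i => l i w).

Hypothesis bounded_l : uniformly_bounded_moments P l.

Lemma lscirc_ncp_subproof n :
  (fun w => map_mx (real_complex R) (random_lscirc n.+1 w))
    \in random_matrix_pred P (n := n).
Proof.
apply/asboolP => i j.
have fm k : finite_moments P (fun w => (l k w)%:C).
  split=> [||m]; [exact: measurable_funPT|exact: measurable_cst|].
  have [B HB] := bounded_l m; apply: le_lt_trans (ltry B).
  rewrite (_ : (fun w => _) = fun w => `|l k w| ^+ m)//.
  by apply/funext => w /=; rewrite expr0n addr0 sqrtr_sqr.
have [ij|ij] := boolP (i + j < n.+1)%N.
  rewrite (_ : (fun w => _) = fun w => (l (i + j)%N w)%:C)//.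
  by apply/funext => w; rewrite !mxE ij.
rewrite (_ : (fun w => _) = fun w => (-1) * (l (i + j - n.+1)%N w)%:C).
  by apply: finite_momentsM => //; exact: finite_moments_cst.
by apply/funext => w; rewrite !mxE (negbTE ij) mulN1r rmorphN.
Qed.

Definition lscirc_ncp n : random_matrix_ncp P n :=
  @RandomMatrix _ _ _ P n _ (lscirc_ncp_subproof n).

End random_left_skew_circulant.

(* Main.v *)
Require Import Defs.
From HB Require Import structures.
From mathcomp Require Import all_boot all_order all_algebra.
From mathcomp Require Import cyclic separable cyclotomic.
From mathcomp Require Import all_classical all_reals all_analysis.
From mathcomp Require Import complex zify ring lra.

Import Order.TTheory GRing.Theory Num.Theory.
Import numFieldNormedType.Exports.

Local Open Scope classical_set_scope.
Local Open Scope ring_scope.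
Local Open Scope complex_scope.

Set Implicit Arguments.
Unset Strict Implicit.
Unset Printing Implicit Defensive.

(** Let N be the size of the matrices, let omega range over the N-th roots of
    -1, and let v be the vector with entries omega^i, i < N.  Since
    the entries of a left skew-circulant matrix L only depend on i + j, with a
    sign change when i + j passes N that omega^N = -1 compensates,
      L v = lambda conj(v)   with   lambda = sum_m l_m omega^m.
    As L is real, L conj(v) = conj(lambda) v as well.  So, in a word in several
    such matrices, the eigenvalues alternate with their conjugates: a word of
    odd length maps v, and one of even length maps conj(v), to the multiple of
    conj(v) by lambda_1 conj(lambda_2) lambda_3 ... ([word_matrixE]).  This scalar
    does not change when the first and third of three letters are exchanged,
    hence these matrices half-commute exactly for each N.  The normalized trace
    of a word of even length is the average over omega of these scalars; for a
    word of odd length only omega^2 = 1 contributes ([mxtrace_word]).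

    It remains to compute the limit of the expectation of such alternating
    products.  The matrices are independent, so it factors into mixed moments
    E lambda^p conj(lambda)^q, one for each matrix, where now lambda is scaled
    by N^(-1/2): it is a linear form in independent standardized inputs, with
    coefficients of modulus h = N^(-1/2) whose squares sum to 0, except for the
    at most one omega with omega^2 = 1.  Expanding one factor of
    lambda^(p+1) conj(lambda)^q over the inputs, and the other factors with
    respect to the selected input, gives
      E lambda^(p+1) conj(lambda)^q = q E lambda^p conj(lambda)^(q-1) + O(h),
    uniformly in the other omega: the terms in which the selected input occurs once
    vanish, those in which it occurs twice pair it with a lambda, and then
    the squares cancel, or with a conj(lambda), and all others are O(h)
    ([form_moment_by_parts]).  This is the recursion of the moments of a
    standard complex Gaussian variable, so the limit is p! if p = q and 0
    otherwise ([form_moment_gaussian]).  The exceptional omega disappears in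
    the average.  Hence a word converges to the product over the letters j of
    p_j!, provided that j occurs p_j times at odd and p_j times at even
    positions for all j, and to 0 otherwise; these are the moments of
    half-independent symmetrized Rayleigh variables
    ([half_independent_of_word_moments]).

    Limit variables are obtained without building a Gaussian model.  The
    matrices belonging to one letter, for all n together, form one element of
    the product over n of the matrix algebras.  These elements generate a star
    subalgebra, and once all word moments converge, the limit of the states is
    a well defined linear functional on it ([limit_ncp_exists]);
    half-commutation is inherited from every factor. *)

(** * Limits of moments as states on a product algebra *)

Section product_algebra.
Variables (C : numClosedFieldType) (A : nat -> starAlgType C).

(** A name for the dependent product, to which the algebra structures can be
    attached. *)
Definition prod_alg := forall n, A n.
Implicit Types f g h : prod_alg.

HB.instance Definition _ := gen_eqMixin prod_alg.
HB.instance Definition _ := gen_choiceMixin prod_alg.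

Let ext f g : (forall n, f n = g n) -> f = g := @functional_extensionality_dep _ _ f g.

Let add f g : prod_alg := fun n => f n + g n.
Let opp f : prod_alg := fun n => - f n.
Let mul f g : prod_alg := fun n => f n * g n.
Let scale (c : C) f : prod_alg := fun n => c *: f n.

Let addA : associative add. Proof. by move=> f g h; apply: ext => n; exact: addrA. Qed.
Let addC : commutative add. Proof. by move=> f g; apply: ext => n; exact: addrC. Qed.
Let add0 : left_id (fun=> 0) add. Proof. by move=> f; apply: ext => n; exact: add0r. Qed.
Let addN : left_inverse (fun=> 0) opp add.
Proof. by move=> f; apply: ext => n; exact: addNr. Qed.
HB.instance Definition _ := GRing.isZmodule.Build prod_alg addA addC add0 addN.

Let mulA : associative mul. Proof. by move=> f g h; apply: ext => n; exact: mulrA. Qed.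
Let mul1 : left_id (fun=> 1) mul. Proof. by move=> f; apply: ext => n; exact: mul1r. Qed.
Let mulr1' : right_id (fun=> 1) mul. Proof. by move=> f; apply: ext => n; exact: mulr1. Qed.
Let mulDl : left_distributive mul add.
Proof. by move=> f g h; apply: ext => n; exact: mulrDl. Qed.
Let mulDr : right_distributive mul add.
Proof. by move=> f g h; apply: ext => n; exact: mulrDr. Qed.
Let one_neq0 : (fun=> 1) != (0 : prod_alg).
Proof.
apply/negP => /eqP E; have := congr1 (fun f : prod_alg => f 0%N) E; move/eqP.
by rewrite (oner_eq0 (A 0)). Qed.
HB.instance Definition _ :=
  GRing.Zmodule_isNzRing.Build prod_alg mulA mul1 mulr1' mulDl mulDr one_neq0.

Let scaleA c d f : scale c (scale d f) = scale (c * d) f.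
Proof. by apply: ext => n; exact: scalerA. Qed.
Let scale1 : left_id 1 scale. Proof. by move=> f; apply: ext => n; exact: scale1r. Qed.
Let scaleDr : right_distributive scale +%R.
Proof. by move=> c f g; apply: ext => n; exact: scalerDr. Qed.
Let scaleDl f : {morph scale^~ f : c d / c + d}.
Proof. by move=> c d; apply: ext => n; exact: scalerDl. Qed.
HB.instance Definition _ :=
  GRing.Zmodule_isLmodule.Build C prod_alg scaleA scale1 scaleDr scaleDl.

Let scaleAl (c : C) f g : c *: (f * g) = c *: f * g.
Proof. by apply: ext => n; exact: scalerAl. Qed.
HB.instance Definition _ := GRing.Lmodule_isLalgebra.Build C prod_alg scaleAl.
Let scaleAr (c : C) f g : c *: (f * g) = f * (c *: g).
Proof. by apply: ext => n; exact: scalerAr. Qed.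
HB.instance Definition _ := GRing.Lalgebra_isAlgebra.Build C prod_alg scaleAr.

Let starp f : prod_alg := fun n => star (f n).
Let starpK : involutive starp. Proof. by move=> f; apply: ext => n; exact: starK. Qed.
Let starpD : {morph starp : f g / f + g}.
Proof. by move=> f g; apply: ext => n; exact: starD. Qed.
Let starpZ (c : C) f : starp (c *: f) = Num.conj c *: starp f.
Proof. by apply: ext => n; exact: starZ. Qed.
Let starpM f g : starp (f * g) = starp g * starp f.
Proof. by apply: ext => n; exact: starM. Qed.
HB.instance Definition _ :=
  Algebra_isStarAlgebra.Build C prod_alg starpK starpD starpZ starpM.

Lemma prod_alg_sumE (I : Type) (r : seq I) (F : I -> prod_alg) n :
  (\sum_(i <- r) F i) n = \sum_(i <- r) F i n.
Proof. by elim: r => [|i r IH]; rewrite ?big_nil// !big_cons -IH. Qed.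

Lemma prod_alg_prodE (I : Type) (r : seq I) (F : I -> prod_alg) n :
  (\prod_(i <- r) F i) n = \prod_(i <- r) F i n.
Proof. by elim: r => [|i r IH]; rewrite ?big_nil// !big_cons -IH. Qed.
End product_algebra.

Section star_algebra_theory.
Variables (C : numClosedFieldType) (A : starAlgType C).

Lemma star1 : star (1 : A) = 1.
Proof. by have := starM (star 1) (1 : A); rewrite mulr1 !starK mulr1. Qed.

Lemma star0 : star (0 : A) = 0.
Proof. by apply: (addrI (star 0)); rewrite -starD !addr0. Qed.

Lemma star_sum (I : Type) (r : seq I) (F : I -> A) :
  star (\sum_(i <- r) F i) = \sum_(i <- r) star (F i).
Proof. by elim: r => [|i r IH]; rewrite ?big_nil ?star0// !big_cons starD IH. Qed.

Lemma star_prod (I : Type) (r : seq I) (F : I -> A) :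
  star (\prod_(i <- r) F i) = \prod_(i <- rev r) star (F i).
Proof.
elim: r => [|i r IH]; first by rewrite !big_nil star1.
by rewrite rev_cons big_rcons big_cons starM IH.
Qed.
End star_algebra_theory.

Section word_span.
Variables (C : numClosedFieldType) (A : starAlgType C) (k : nat).
Variable (a : 'I_k -> A).
Hypothesis star_a : forall j, star (a j) = a j.

(** The span of the words in self-adjoint elements is the star subalgebra that
    they generate; its elements are given by explicit finite combinations, so
    that moments of words determine a state on it. *)
Definition word_comb (r : seq (C * seq 'I_k)) : A :=
  \sum_(cs <- r) cs.1 *: \prod_(j <- cs.2) a j.

Definition word_span_pred : {pred A} := fun x => `[< exists r, x = word_comb r >].

Record word_span := WordSpan {
  word_span_val :> A; _ : word_span_val \in word_span_pred }.

HB.instance Definition _ := [isSub for word_span_val].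
HB.instance Definition _ := [Choice of word_span by <:].

Lemma word_span_closed : GRing.subsemialg_closed word_span_pred.
Proof.
split.
- apply/asboolP; exists [:: (1, [::])].
  by rewrite /word_comb big_seq1 big_nil scale1r.
- split; first by apply/asboolP; exists [::]; rewrite /word_comb big_nil.
  move=> x y /asboolP[r ->] /asboolP[s ->]; apply/asboolP; exists (r ++ s).
  by rewrite /word_comb big_cat.
- move=> c x /asboolP[r ->]; apply/asboolP; exists [seq (c * cs.1, cs.2) | cs <- r].
  rewrite /word_comb big_map scaler_sumr.
  by apply: eq_bigr => cs _; rewrite scalerA.
- move=> x y /asboolP[r ->] /asboolP[s ->]; apply/asboolP.
  exists [seq (cs.1 * dt.1, cs.2 ++ dt.2) | cs <- r, dt <- s].
  rewrite /word_comb big_allpairs_dep mulr_suml; apply: eq_bigr => cs _.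
  rewrite mulr_sumr; apply: eq_bigr => dt _.
  by rewrite big_cat -scalerAl -scalerAr scalerA.
Qed.

HB.instance Definition _ :=
  GRing.SubChoice_isSubAlgebra.Build C A word_span_pred word_span word_span_closed.

Lemma word_span_star_subproof (x : word_span) :
  star (val x) \in word_span_pred.
Proof.
have /asboolP[r ->] := valP x; apply/asboolP.
exists [seq (Num.conj cs.1, rev cs.2) | cs <- r].
rewrite /word_comb big_map star_sum; apply: eq_bigr => cs _.
by rewrite starZ star_prod; under eq_bigr do rewrite star_a.
Qed.

Definition word_span_star (x : word_span) : word_span :=
  WordSpan (word_span_star_subproof x).

Let word_span_starK : involutive word_span_star.
Proof. by move=> x; apply: val_inj; exact: starK. Qed.
Let word_span_starD : {morph word_span_star : x y / x + y}.
Proof. by move=> x y; apply: val_inj; exact: starD. Qed.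
Let word_span_starZ (c : C) (x : word_span) :
  word_span_star (c *: x) = Num.conj c *: word_span_star x.
Proof. by apply: val_inj; exact: starZ. Qed.
Let word_span_starM x y : word_span_star (x * y) = word_span_star y * word_span_star x.
Proof. by apply: val_inj; exact: starM. Qed.
Definition word_span_isStar := Algebra_isStarAlgebra.Build C word_span
  word_span_starK word_span_starD word_span_starZ word_span_starM.

Lemma word_span_gen_subproof j : a j \in word_span_pred.
Proof.
apply/asboolP; exists [:: (1, [:: j])].
by rewrite /word_comb !big_seq1 scale1r.
Qed.
Definition word_span_gen j := WordSpan (word_span_gen_subproof j).
End word_span.

Section limit_ncp.
Variables (C : numClosedFieldType) (An : nat -> ncp C) (k : nat).
Variable an : forall n, 'I_k -> An n.
Hypothesis star_an : forall n j, star (an n j) = an n j.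
Variable v : seq 'I_k -> C.
Hypothesis cvg_an : forall s,
  ncp_state (An n) (\prod_(j <- s) an n j) @[n --> \oo] --> v s.

Let B : starAlgType C := prod_alg An.
Let b (j : 'I_k) : B := fun n => an n j.
Let star_b j : star (b j) = b j.
Proof. by apply: functional_extensionality_dep => n; exact: star_an. Qed.

Definition limit_alg := word_span b.
HB.instance Definition _ := GRing.Algebra.on limit_alg.
HB.instance Definition _ : Algebra_isStarAlgebra C limit_alg := word_span_isStar star_b.

Definition limit_state (x : limit_alg) : C :=
  lim (ncp_state (An n) (val x n) @[n --> \oo]).

(** On the span of words the limit exists for each element, hence is linear,
    although it need not exist on the whole product. *)
Lemma is_cvg_limit_state (x : limit_alg) :
  cvg (ncp_state (An n) (val x n) @[n --> \oo]).
Proof.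
have /asboolP[r ->] := valP x.
have E n : ncp_state (An n) ((word_comb b r : B) n) =
   \sum_(cs <- r) cs.1 * ncp_state (An n) (\prod_(j <- cs.2) an n j).
  rewrite /word_comb prod_alg_sumE raddf_sum; apply: eq_bigr => cs _ /=.
  transitivity (ncp_state (An n) (cs.1 *: \prod_(j <- cs.2) an n j)).
    congr (ncp_state _ _); rewrite -[RHS]/(cs.1 *: \prod_(j <- cs.2) b j n).
    by rewrite -prod_alg_prodE.
  by rewrite linearZ.
rewrite (funext E); elim: r {E} => [|cs r IH].
  by under eq_fun do rewrite big_nil; exact: is_cvg_cst.
under eq_fun do rewrite big_cons.
by apply: is_cvgD => //; apply: is_cvgMl_tmp; apply/cvg_ex; exists (v cs.2).
Qed.

Let limit_state_scalar : scalar limit_state.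
Proof.
move=> c x y; rewrite /limit_state.
have E n : ncp_state (An n) (val (c *: x + y) n) =
  c * ncp_state (An n) (val x n) + ncp_state (An n) (val y n).
  by rewrite linearP.
rewrite (funext E); apply/cvg_lim => //.
by apply: cvgD; [apply: cvgMl_tmp|]; exact: is_cvg_limit_state.
Qed.
HB.instance Definition _ := GRing.isLinear.Build C limit_alg C *%R
  limit_state limit_state_scalar.

Let limit_state1 : limit_state 1 = 1.
Proof.
rewrite /limit_state (funext (fun n => ncp_state1 (An n))).
exact: lim_cst.
Qed.
Definition limit_ncp : ncp C := @Ncp C limit_alg limit_state limit_state1.
Definition limit_var (j : 'I_k) : limit_ncp := word_span_gen b j.

Lemma star_limit_var j : star (limit_var j) = limit_var j.
Proof. by apply: val_inj; exact: star_b. Qed.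

Lemma limit_var_ind (x y : limit_ncp) :
  (forall n, val (x : limit_alg) n = val (y : limit_alg) n) -> x = y.
Proof. by move=> xy; apply/val_inj/functional_extensionality_dep. Qed.

Lemma state_limit_word s : ncp_state limit_ncp (\prod_(j <- s) limit_var j) = v s.
Proof.
have E n : ncp_state (An n) (val (\prod_(j <- s) limit_var j : limit_alg) n) =
    ncp_state (An n) (\prod_(j <- s) an n j).
  congr (ncp_state _ _).
  by elim: s => [|j s IH]; rewrite ?big_nil// !big_cons -IH.
by rewrite -[LHS]/(limit_state _) /limit_state (funext E); exact: cvg_lim (cvg_an (s := s)).
Qed.

Lemma half_commute_limit_var :
  (forall n, half_commute (an n)) -> half_commute limit_var.
Proof. by move=> hc i j l; apply: limit_var_ind => n; exact: hc. Qed.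

(** Identities that hold for each n hold in the product algebra, and the state
    of a word is by construction the limit of its moments. *)
Lemma limit_ncp_exists : (forall n, half_commute (an n)) ->
  exists (A : ncp C) (a : 'I_k -> A),
    [/\ forall j, star (a j) = a j, half_commute a &
        forall s, ncp_state A (\prod_(j <- s) a j) = v s].
Proof.
move=> hc; exists limit_ncp, limit_var; split.
- exact: star_limit_var.
- exact: half_commute_limit_var.
- exact: state_limit_word.
Qed.
End limit_ncp.

(** * Words in half-independent Rayleigh variables *)

Section gaussian_words.
Variables (C : numClosedFieldType) (k : nat).

(** Removing the first letter exchanges odd and even positions; this recursive
    form of the position counts follows the recursive structure of words. *)
Fixpoint parity_count (odd_position : bool) (s : seq 'I_k) (j : 'I_k) : nat :=
  if s is i :: s' then
    (odd_position && (i == j)) + parity_count (~~ odd_position) s' j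
  else 0.

Lemma occurrences_atE b (s : seq 'I_k) j : occurrences_at b s j = parity_count b s j.
Proof.
rewrite /occurrences_at -sum1_card.
transitivity (\sum_(t < size s) ((odd t.+1 == b) && (nth j s t == j)))%N.
  rewrite big_mkcond; apply: eq_bigr => t _; rewrite inE (tnth_nth j).
  by case: ifP.
elim: s b => [|i s IH] b; first by rewrite big_ord0.
rewrite big_ord_recl /=; congr (_ + _)%N.
rewrite -IH; apply: eq_bigr => t _; rewrite add0n.
by rewrite negbK /=; case: (odd t) => /=; case: b.
Qed.

(** The limit moment of a word: the expectation of the alternating product
    Z_(s1) conj(Z_(s2)) Z_(s3) ... of independent standard complex Gaussian
    variables Z_j. *)
Definition rayleigh_word (s : seq 'I_k) : C :=
  \prod_j (if parity_count true s j == parity_count false s j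
           then ((parity_count true s j)`!)%:R else 0).

Lemma rayleigh_word_eq0 s : ~ symmetric_word s -> rayleigh_word s = 0.
Proof.
move=> nsym; have [j nj] : exists j, parity_count true s j != parity_count false s j.
  apply: contrapT => /forallNP h; apply: nsym => j.
  by rewrite !occurrences_atE; apply/eqP; have /negP := h j; rewrite negbK.
by rewrite /rayleigh_word (bigD1 j) //= (negbTE nj) mul0r.
Qed.

Lemma parity_count_cat b (s t : seq 'I_k) j :
  parity_count b (s ++ t) j = (parity_count b s j + parity_count (odd (size s) (+) b) t j)%N.
Proof.
elim: s b => [|i s IH] b /=; first by [].
by rewrite IH addnA; congr (_ + parity_count _ t j)%N; case: (odd _); case: b.
Qed.

Lemma parity_count_nseq2 b m (i j : 'I_k) :
  parity_count b (nseq (2 * m) i) j = (if i == j then m else 0)%N.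
Proof.
rewrite mul2n; elim: m => [|m IH]; first by rewrite if_same.
rewrite doubleS /= negbK IH; case: (i == j) => /=; case: (b : bool) {IH} => /=; lia.
Qed.

Variables (A : ncp C) (a : 'I_k -> A).
Hypothesis star_a : forall j, star (a j) = a j.
Hypothesis hc_a : half_commute a.
Hypothesis state_a : forall s, ncp_state A (\prod_(j <- s) a j) = rayleigh_word s.

Lemma state_square_word (m : 'I_k -> nat) :
  ncp_state A (\prod_(j < k) (a j ^+ 2) ^+ m j) = \prod_j ((m j)`!)%:R.
Proof.
have E (r : seq 'I_k) : \prod_(j <- r) (a j ^+ 2) ^+ m j =
    \prod_(i <- flatten [seq nseq (2 * m j) j | j <- r]) a i.
  elim: r => [|j r IH]; first by rewrite !big_nil.
  by rewrite /= big_cat big_cons IH big_nseq -Monoid.iteropE -exprM.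
have cnt b (r : seq 'I_k) i : uniq r ->
    parity_count b (flatten [seq nseq (2 * m j) j | j <- r]) i =
    (if i \in r then m i else 0)%N.
  elim: r => [//|j r IH] /= /andP[jr ur].
  rewrite parity_count_cat size_nseq mul2n odd_double -mul2n parity_count_nseq2 IH//.
  rewrite inE eq_sym; case: (eqVneq i j) => [->|//].
  by rewrite (negbTE jr) addn0.
rewrite E state_a; apply: eq_bigr => i _.
by rewrite !cnt ?index_enum_uniq// mem_index_enum eqxx.
Qed.

Lemma rayleigh_of_word_moments j : standard_symmetrized_rayleigh (a j).
Proof.
split=> // m m0; have pw n : a j ^+ n = \prod_(i <- nseq n j) a i.
  by rewrite big_nseq -Monoid.iteropE.
rewrite !pw !state_a; split; last first.
  rewrite /rayleigh_word (bigD1 j) //= !parity_count_nseq2 !eqxx big1 ?mulr1//.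
  by move=> i ij; rewrite !parity_count_nseq2 eq_sym (negbTE ij) eqxx.
apply: rayleigh_word_eq0 => /(_ j); rewrite !occurrences_atE.
case: m m0 => // m _; have -> : (2 * m.+1).-1 = (2 * m).+1 by lia.
by rewrite /= !parity_count_nseq2 !eqxx /=; lia.
Qed.

(** Each square word contains its letters equally often at odd and at even
    positions, so independence of the squares is the product form of
    [rayleigh_word]; the squares commute because a b b = b b a. *)
Lemma half_independent_of_word_moments : half_independent a.
Proof.
split=> //; last by move=> s ns; rewrite state_a rayleigh_word_eq0.
split.
  move=> i j; rewrite !expr2 !mulrA hc_a -!mulrA; congr (_ * _).
  by rewrite !mulrA hc_a.
move=> m; rewrite state_square_word; apply: eq_bigr => j _; symmetry.
rewrite -(exprM (a j)); case: (m j) => [|n]; first by rewrite expr0 ncp_state1.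
by have [_ /(_ n.+1 isT) [_ ->]] := rayleigh_of_word_moments j.
Qed.
End gaussian_words.

(** * Expectations of products of independent variables *)

Section factorization_real.
Context d (T : measurableType d) (R : realType) (P : probability T R).
Local Notation integrable f := (P.-integrable setT (fun w => (f w)%:E)).
Implicit Types f Y : T -> R.

Lemma integrable_bounded_mul (h Y : T -> R) (M : R) :
  measurable_fun setT h -> (forall w, `|h w| <= M) -> integrable Y ->
  integrable (fun w => h w * Y w).
Proof.
move=> mh hM iY; have /measurable_EFinP mY := measurable_int _ iY.
have iMY : integrable (fun w => M * `|Y w|).
  apply: (eq_integrable measurableT (fun w => M%:E * `|(Y w)%:E|)%E) => //.
  by apply: integrableZl => //; exact: integrable_abse.
apply: le_integrable iMY => //.
  by apply/measurable_EFinP; exact: measurable_funM.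
move=> w _; rewrite !abse_EFin lee_fin !normrM normr_id.
by apply: ler_wpM2r => //; apply: le_trans (hM w) (ler_norm _).
Qed.


Variable Y : T -> R.
Hypothesis iY : integrable Y.

(** Integrability is part of the notion so that it is stable under sums. *)
Definition factorizes (h : T -> R) : Prop :=
  [/\ integrable h, integrable (fun w => h w * Y w) &
   Rintegral P setT (fun w => h w * Y w) = Rintegral P setT h * Rintegral P setT Y].

Lemma factorizesD h1 h2 :
  factorizes h1 -> factorizes h2 -> factorizes (fun w => h1 w + h2 w).
Proof.
move=> [i1 j1 e1] [i2 j2 e2]; split.
- by under eq_fun do rewrite EFinD; exact: integrableD.
- by under eq_fun do rewrite mulrDl EFinD; exact: integrableD.
- by under eq_Rintegral do rewrite mulrDl; rewrite !RintegralD// e1 e2 mulrDl.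
Qed.

Lemma factorizesZ c h : factorizes h -> factorizes (fun w => c * h w).
Proof.
move=> [i1 j1 e1]; split; first by under eq_fun do rewrite EFinM; exact: integrableZl.
  by under eq_fun do rewrite -mulrA EFinM; exact: integrableZl.
by under eq_Rintegral do rewrite -mulrA; rewrite !RintegralZl// e1 mulrA.
Qed.

Lemma factorizes0 : factorizes (fun=> 0).
Proof.
have i0 : integrable (fun=> 0) by exact: integrable0.
split=> //; first by under eq_fun do rewrite mul0r.
by under eq_Rintegral do rewrite mul0r; rewrite Rintegral_cst// !mul0r.
Qed.

Lemma factorizes_sum (I : Type) (r : seq I) (h : I -> T -> R) :
  (forall i, factorizes (h i)) -> factorizes (fun w => \sum_(i <- r) h i w).
Proof.
move=> Hh; elim: r => [|i r IH].
  by under eq_fun do rewrite big_nil; exact: factorizes0.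
by under eq_fun do rewrite big_cons; exact: factorizesD.
Qed.

(** Dominated convergence applies to both sides. *)
Lemma factorizes_dominated (g : nat -> T -> R) (h : T -> R) :
  (forall n, factorizes (g n)) ->
  (forall w, g n w @[n --> \oo] --> h w) -> (forall n w, `|g n w| <= `|h w|) ->
  integrable h -> integrable (fun w => h w * Y w) -> factorizes h.
Proof.
move=> gf gh gle ih ihY; split=> //.
have dct (Z : T -> R) : measurable_fun setT Z -> integrable (fun w => h w * Z w) ->
    Rintegral P setT (fun w => g n w * Z w) @[n --> \oo] -->
    Rintegral P setT (fun w => h w * Z w).
  move=> mZ ihZ.
  have mg n : measurable_fun setT (g n).
    by have [/measurable_int/measurable_EFinP] := gf n.
  have [] := @dominated_convergence _ _ _ P setT measurableT
    (fun n w => (g n w * Z w)%:E) (fun w => (h w * Z w)%:E) (fun w => `|(h w * Z w)%:E|)%E.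
  - by move=> n; apply/measurable_EFinP; exact: measurable_funM.
  - exact: measurable_int ihZ.
  - apply: aeW => w _; apply: cvg_EFin; first exact: nearW.
    by apply: cvgMr_tmp; exact: gh.
  - exact: integrable_abse.
  - apply: aeW => w n _; rewrite !abse_EFin lee_fin !normrM.
    by apply: ler_wpM2r => //; exact: gle.
  move=> _ _ dc; apply: fine_cvg.
  by rewrite /Rintegral fineK//; exact: integrable_fin_num.
have /measurable_EFinP mY := measurable_int _ iY.
have c1 := dct Y mY ihY.
have c2 : Rintegral P setT (g n) @[n --> \oo] --> Rintegral P setT h.
  have E (u : T -> R) : (fun w => u w * 1) = u by apply/funext => w; rewrite mulr1.
  have ih1 : integrable (fun w => h w * 1) by under eq_fun do rewrite mulr1.
  have := dct (fun=> 1) (measurable_cst _) ih1; rewrite E.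
  by under eq_fun do rewrite E.
have E n : Rintegral P setT (fun w => g n w * Y w) = Rintegral P setT (g n) * Rintegral P setT Y.
  by have [] := gf n.
rewrite -(cvg_lim _ c1)//; under eq_fun do rewrite E.
by apply: cvg_lim => //; exact: cvgMr_tmp.
Qed.

Variable f : T -> R.
Hypothesis mf : measurable_fun setT f.
Hypothesis fact_event : forall B : set R, measurable B ->
  Rintegral P setT (fun w => \1_B (f w) * Y w) =
  Rintegral P setT (fun w => \1_B (f w)) * Rintegral P setT Y.

Let factorizes_indic (B : set R) : measurable B -> factorizes (fun w => \1_B (f w)).
Proof.
move=> mB.
have mh : measurable_fun setT (fun w => \1_B (f w) : R).
  exact: (measurableT_comp (measurable_indic mB) mf).
have h1 w : `|\1_B (f w) : R| <= 1.
  by rewrite indicE; case: (_ \in _); rewrite ?normr0 ?normr1.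
split; last exact: fact_event.
  under eq_fun do rewrite -[X in X%:E]mulr1.
  apply: (integrable_bounded_mul (M := 1)) => //.
  exact: finite_measure_integrable_cst.
exact: (integrable_bounded_mul (M := 1)).
Qed.

Import HBNNSimple HBSimple.

Lemma factorizes_ge0 (phi : R -> R) :
  measurable_fun setT phi -> (forall x, 0 <= phi x) ->
  integrable (fun w => phi (f w)) -> integrable (fun w => phi (f w) * Y w) ->
  factorizes (fun w => phi (f w)).
Proof.
move=> mphi phi0 iphi iphiY.
have mE : measurable_fun setT (EFin \o phi) by exact/measurable_EFinP.
pose g n := nnsfun_approx measurableT mE n.
have g0 n x : 0 <= g n x by exact: fun_ge0.
have gphi x : g n x @[n --> \oo] --> phi x.
  have /= := cvg_nnsfun_approx measurableT mE (fun x _ => phi0 x : (0 <= (phi x)%:E)%E) (x := x) I.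
  by move/fine_cvgP => [_].
have gle n x : g n x <= phi x.
  have ndg : nondecreasing_seq (fun n => g n x).
    by move=> m p mp; have /lefP := nd_nnsfun_approx measurableT mE mp; exact.
  have := nondecreasing_cvgn_le ndg (cvgP _ (gphi x)) n.
  by rewrite (cvg_lim _ (gphi x)).
apply: (factorizes_dominated (g := fun n w => g n (f w))) => //.
- move=> n; under eq_fun do rewrite fimfunEord.
  apply: factorizes_sum => i; apply: factorizesZ.
  exact: factorizes_indic.
- by move=> n w; rewrite !ger0_norm.
Qed.

(** Factorization passes from the events of [f] to [f] by linearity and
    approximation by simple functions, separately for the positive and the
    negative part; [Y] may have any sign. *)
Lemma factorizes_of_events :
  integrable f -> integrable (fun w => f w * Y w) -> factorizes f.
Proof.
move=> if_ ifY.
have part (phi : R -> R) : measurable_fun setT phi -> (forall x, 0 <= phi x) ->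
    (forall x, phi x <= `|x|) -> factorizes (fun w => phi (f w)).
  move=> mphi phi0 phile.
  have mpf : measurable_fun setT (fun w => phi (f w)) by exact: measurableT_comp.
  have /measurable_EFinP mY := measurable_int _ iY.
  apply: factorizes_ge0 => //.
    apply: le_integrable if_ => //; first exact/measurable_EFinP.
    by move=> w _; rewrite !abse_EFin lee_fin ger0_norm.
  apply: le_integrable ifY => //; first exact/measurable_EFinP/measurable_funM.
  move=> w _; rewrite !abse_EFin lee_fin !normrM.
  by apply: ler_wpM2r => //; rewrite ger0_norm.
have mid : measurable_fun setT (fun x : R => x) by exact: measurable_id.
have -> : f = (fun w => Num.max (f w) 0 + (-1) * Num.max (- f w) 0).
  apply/funext => w; rewrite mulN1r.
  by case: (leP (f w) 0) => h; rewrite /Num.max; case: ifPn; lra.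
apply: factorizesD; last apply: factorizesZ.
  apply: (part (fun x => Num.max x 0)) => [|x|x].
  - exact: measurable_maxr.
  - by rewrite le_max lexx orbT.
  - by rewrite ge_max normr_ge0 ler_norm.
apply: (part (fun x => Num.max (- x) 0)) => [|x|x].
- by apply: measurable_maxr => //; exact: measurableT_comp.
- by rewrite le_max lexx orbT.
- by rewrite ge_max normr_ge0 -normrN ler_norm.
Qed.
End factorization_real.

Section complex_factorization.
Context d (T : measurableType d) (R : realType) (P : probability T R).
Local Notation C := R[i].
Local Notation cE := (cexpectation P).
Local Notation fm := (finite_moments P).
Implicit Types (X Y : T -> C) (f : T -> R).

Lemma cexpectationE X : cE X =
  Rintegral P setT (fun w => complex.Re (X w)) +i*
  Rintegral P setT (fun w => complex.Im (X w)).
Proof. by rewrite /cexpectation unlock. Qed.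

Lemma finite_moments_integrable X : fm X ->
  P.-integrable setT (fun w => (complex.Re (X w))%:E) /\
  P.-integrable setT (fun w => (complex.Im (X w))%:E).
Proof.
move=> /finite_moments_Lfun[/Lfun1_integrable Xr /Lfun1_integrable Xi].
by split.
Qed.

Lemma finite_moments_indic (A : set T) :
  measurable A -> fm (fun w => (\1_A w : R)%:C).
Proof.
move=> mA; split => [||m] /=.
- exact: measurable_indic.
- exact: measurable_cst.
apply: (@dominated_expectation _ _ _ P _ (cst 1) (cst 1) 1).
- have : measurable_fun setT (fun w => `|\1_A w : R| ^+ m).
    by apply/measurable_funX/measurableT_comp => //; exact: measurable_indic.
  apply: eq_measurable_fun => w _ /=.
  by rewrite expr0n addr0 sqrtr_sqr.
- exact: measurable_cst.
- exact: measurable_cst.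
- by move=> w; rewrite exprn_ge0// sqrtr_ge0.
- by [].
- by [].
- by [].
- move=> w; rewrite expr0n addr0 sqrtr_sqr indicE mul1r.
  by case: (w \in A); rewrite /= ?normr1 ?normr0 ?expr1n ?expr0n//; case: m => //= *; lra.
- by rewrite expectation_cst ltry.
- by rewrite expectation_cst ltry.
Qed.

Lemma cexpectation_indic (A : set T) :
  measurable A -> cE (fun w => (\1_A w : R)%:C) = (fine (P A))%:C.
Proof.
move=> mA; rewrite /cexpectation /= (expectation_indic P mA).
by rewrite (expectation_cst P 0).
Qed.

Lemma cexpectation_mul_real f X Y : X = (fun w => (f w)%:C) ->
  cE (fun w => X w * Y w) =
  Rintegral P setT (fun w => f w * complex.Re (Y w)) +i*
  Rintegral P setT (fun w => f w * complex.Im (Y w)).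
Proof.
move=> ->; rewrite cexpectationE; congr (_ +i* _); apply: eq_Rintegral => w _.
  by case: (Y w) => a b /=; rewrite mul0r subr0.
by case: (Y w) => a b /=; rewrite mul0r addr0.
Qed.

Lemma cexpectation_real f : cE (fun w => (f w)%:C) = (Rintegral P setT f)%:C.
Proof. by rewrite cexpectationE /= Rintegral_cst// mul0r. Qed.

Lemma cexpectation_mul_real_factor f Y :
  fm (fun w => (f w)%:C) -> fm Y ->
  (forall B : set R, measurable B ->
    cE (fun w => (\1_B (f w) : R)%:C * Y w) =
    cE (fun w => (\1_B (f w) : R)%:C) * cE Y) ->
  cE (fun w => (f w)%:C * Y w) = cE (fun w => (f w)%:C) * cE Y.
Proof.
move=> fmf fmY fact.
have [if_ _] := finite_moments_integrable fmf.
have [iYr iYi] := finite_moments_integrable fmY.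
have [ifYr ifYi] := finite_moments_integrable (finite_momentsM fmf fmY).
have mf : measurable_fun setT f by have [] := fmf.
have {}ifYr : P.-integrable setT (fun w => (f w * complex.Re (Y w))%:E).
  apply: eq_integrable ifYr => // w _; congr (_%:E).
  by case: (Y w) => a b /=; rewrite mul0r subr0.
have {}ifYi : P.-integrable setT (fun w => (f w * complex.Im (Y w))%:E).
  apply: eq_integrable ifYi => // w _; congr (_%:E).
  by case: (Y w) => a b /=; rewrite mul0r addr0.
have factB B : measurable B ->
  Rintegral P setT (fun w => \1_B (f w) * complex.Re (Y w)) =
    Rintegral P setT (fun w => \1_B (f w)) * Rintegral P setT (fun w => complex.Re (Y w)) /\
  Rintegral P setT (fun w => \1_B (f w) * complex.Im (Y w)) =
    Rintegral P setT (fun w => \1_B (f w)) * Rintegral P setT (fun w => complex.Im (Y w)).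
  move=> mB; have := fact B mB.
  rewrite (cexpectation_mul_real _ (f := fun w => \1_B (f w))) // cexpectation_real.
  by rewrite [cE Y]cexpectationE; case; rewrite !mul0r subr0 addr0.
have [_ _ e1] := factorizes_of_events iYr mf (fun B mB => (factB B mB).1) if_ ifYr.
have [_ _ e2] := factorizes_of_events iYi mf (fun B mB => (factB B mB).2) if_ ifYi.
rewrite (cexpectation_mul_real _ (f := f)) // cexpectation_real e1 e2 [cE Y]cexpectationE.
by apply/eqP; rewrite eq_complex /= !mul0r subr0 addr0 !eqxx.
Qed.

Lemma finite_moments_Re X : fm X -> fm (fun w => (complex.Re (X w))%:C).
Proof.
move=> fX; have E : (fun w => (complex.Re (X w))%:C) =
   fun w => (2^-1)%:C * (X w + Num.conj (X w)).
  apply/funext => w; case: (X w) => a b; apply/eqP.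
  by rewrite eq_complex /= subrr !mulr0 subr0 mul0r addr0 eqxx andbT; apply/eqP; lra.
rewrite E; apply: finite_momentsM; first exact: finite_moments_cst.
by apply: finite_momentsD => //; exact: finite_moments_conj.
Qed.

Lemma finite_moments_Im X : fm X -> fm (fun w => (complex.Im (X w))%:C).
Proof.
move=> fX.
have E : (fun w => (complex.Im (X w))%:C) =
   fun w => (complex.Re (- 'i%C * X w))%:C.
  by apply/funext => w; case: (X w) => a b /=; rewrite oppr0 mul0r sub0r mulN1r opprK.
rewrite E; apply: finite_moments_Re; apply: finite_momentsM => //.
exact: finite_moments_cst.
Qed.

Lemma cexpectationM_of_events X Y : fm X -> fm Y ->
  (forall B : set R, measurable B ->
    cE (fun w => (\1_B (complex.Re (X w)) : R)%:C * Y w) =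
    cE (fun w => (\1_B (complex.Re (X w)) : R)%:C) * cE Y) ->
  (forall B : set R, measurable B ->
    cE (fun w => (\1_B (complex.Im (X w)) : R)%:C * Y w) =
    cE (fun w => (\1_B (complex.Im (X w)) : R)%:C) * cE Y) ->
  cE (fun w => X w * Y w) = cE X * cE Y.
Proof.
move=> fX fY hr hi; have fr := finite_moments_Re fX; have fi := finite_moments_Im fX.
have fi' : fm (fun w => 'i%C * (complex.Im (X w))%:C).
  by apply: finite_momentsM => //; exact: finite_moments_cst.
have E1 : (fun w => X w * Y w) = (fun w => (complex.Re (X w))%:C * Y w +
    'i%C * ((complex.Im (X w))%:C * Y w)).
  by apply/funext => w; rewrite {1}(complexE (X w)) mulrDl mulrA.
have E2 : cE X = cE (fun w => (complex.Re (X w))%:C) + 'i%C * cE (fun w => (complex.Im (X w))%:C).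
  by rewrite -cexpectationZ// -cexpectationD//; congr cexpectation; apply/funext => w; exact: complexE.
have frY := finite_momentsM fr fY; have fiY := finite_momentsM fi fY.
have fiY' := finite_momentsM (finite_moments_cst P 'i%C) fiY.
rewrite E1 cexpectationD// cexpectationZ//.
rewrite (cexpectation_mul_real_factor fr)// (cexpectation_mul_real_factor fi)// E2.
by rewrite mulrDl mulrA.
Qed.

Lemma finite_momentsX X n : fm X -> fm (fun w => X w ^+ n).
Proof.
move=> fX; elim: n => [|n IH].
  by under eq_fun do rewrite expr0; exact: finite_moments_cst.
by under eq_fun do rewrite exprS; exact: finite_momentsM.
Qed.

Lemma finite_moments_prod (I : Type) (r : seq I) (Z : I -> T -> C) :
  (forall i, fm (Z i)) -> fm (fun w => \prod_(i <- r) Z i w).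
Proof.
move=> HZ; elim: r => [|i r IHr].
  by under eq_fun do rewrite big_nil; exact: finite_moments_cst.
by under eq_fun do rewrite big_cons; exact: finite_momentsM.
Qed.

Lemma cexpectation_sum (I : Type) (r : seq I) (Z : I -> T -> C) :
  (forall i, fm (Z i)) -> cE (fun w => \sum_(i <- r) Z i w) = \sum_(i <- r) cE (Z i).
Proof.
move=> HZ; elim: r => [|i r IHr].
  by under eq_fun do rewrite big_nil; rewrite big_nil cexpectation_cst.
under eq_fun do rewrite big_cons.
by rewrite (cexpectationD (HZ i) (finite_moments_sum r HZ)) big_cons IHr.
Qed.

Lemma cexpectation_conj X : fm X -> cE (fun w => Num.conj (X w)) = Num.conj (cE X).
Proof.
move=> fX; have [iXr iXi] := finite_moments_integrable fX.
rewrite !cexpectationE; apply/eqP; rewrite eq_complex /=; apply/andP; split; apply/eqP.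
  by apply: eq_Rintegral => w _; case: (X w).
transitivity (Rintegral P setT (fun w => -1 * complex.Im (X w))).
  by apply: eq_Rintegral => w _; case: (X w) => a b /=; rewrite mulN1r.
by rewrite RintegralZl// mulN1r.
Qed.

End complex_factorization.

Section independent_products.
Context d (T : measurableType d) (R : realType) (P : probability T R).
Local Notation C := R[i].
Local Notation cE := (cexpectation P).
Local Notation fm := (finite_moments P).

Definition adapted (F : set_system T) (X : T -> C) : Prop :=
  forall B : set R, measurable B ->
    F ((fun w => complex.Re (X w)) @^-1` B) /\
    F ((fun w => complex.Im (X w)) @^-1` B).

Variables (I : choiceType) (F : I -> set_system T).
Hypothesis measurable_F : forall i A, F i A -> measurable A.
Hypothesis indep_F : independent_set_systems P F.
Variable Z : I -> T -> C.
Hypothesis fm_Z : forall i, fm (Z i).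
Hypothesis adapted_Z : forall i, adapted (F i) (Z i).

Lemma cexpectation_indic_prod (s : seq I) (E : I -> set T) :
  uniq s -> (forall i, i \in s -> F i (E i)) ->
  cE (fun w => \prod_(i <- s) (\1_(E i) w : R)%:C) = \prod_(i <- s) (fine (P (E i)))%:C.
Proof.
move=> us FE; pose J := [fset i in s]%fset.
have pJ : perm_eq s (enum_fset J).
  by apply: uniq_perm => // i; rewrite /J !inE.
have mE : measurable (\bigcap_(i in [set` J]) E i).
  by apply: fin_bigcap_measurable => // i /=; rewrite !inE => /FE /measurable_F.
have -> : (fun w => \prod_(i <- s) (\1_(E i) w : R)%:C) =
   (fun w => (\1_(\bigcap_(i in [set` J]) E i) w : R)%:C).
  apply/funext => w; rewrite -rmorph_prod /=; congr (_%:C).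
  rewrite indicE; case: (boolP (w \in _)) => [|].
    rewrite inE => h; rewrite big_seq big1// => i si.
    by rewrite indicE mem_set//; apply: h; rewrite /= !inE.
  rewrite notin_setE /bigcap /= => /existsNP[i /not_implyP[iJ nE]].
  have si : i \in s by move: iJ; rewrite !inE.
  by rewrite (big_rem i si) /= indicE memNset// mul0r.
rewrite cexpectation_indic// indep_F; last by move=> i; rewrite !inE; exact: FE.
rewrite -rmorph_prod /=; congr (_%:C).
rewrite (perm_big _ pJ) /=.
have : {subset enum_fset J <= s} by move=> i; rewrite (perm_mem pJ).
elim: (enum_fset J) => [|i r IH] rs; first by rewrite !big_nil.
have si : i \in s by apply: rs; rewrite mem_head.
have finr : (\prod_(j <- r) P (E j))%E \is a fin_num.
  rewrite big_seq; apply: (big_ind (fun x => x \is a fin_num)) => // [x y|j jr].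
    exact: fin_numM.
  apply/fin_num_measure/measurable_F/FE/rs.
  by rewrite inE jr orbT.
rewrite !big_cons fineM// ?IH//; first by move=> j jr; apply: rs; rewrite inE jr orbT.
exact/fin_num_measure/measurable_F/FE.
Qed.

(** Indicators are replaced by variables one at a time: the variable that is
    next to be treated is uncorrelated with the rest of the product as soon as
    all its events are, and this is the same statement with one more
    indicator. *)
Lemma cexpectation_indic_prodM (s2 s1 : seq I) (E : I -> set T) :
  uniq (s1 ++ s2) -> (forall i, i \in s1 -> F i (E i)) ->
  cE (fun w => (\prod_(i <- s1) (\1_(E i) w : R)%:C) * \prod_(i <- s2) Z i w) =
  (\prod_(i <- s1) (fine (P (E i)))%:C) * \prod_(i <- s2) cE (Z i).
Proof.
elim: s2 s1 E => [|i s2 IH] s1 E us FE.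
  under eq_fun do rewrite big_nil mulr1.
  by rewrite big_nil mulr1 cexpectation_indic_prod// -(cats0 s1).
have [us1 us12 i1] : [/\ uniq (i :: s1 ++ s2), uniq (s1 ++ s2) & i \notin s1].
  have /andP[i12 u12] : uniq (i :: s1 ++ s2) by rewrite -[_ :: _]cat1s uniq_catCA.
  by split; rewrite /= ?i12 ?u12 //; apply: contra i12; rewrite mem_cat => ->.
pose Y w := (\prod_(j <- s1) (\1_(E j) w : R)%:C) * \prod_(j <- s2) Z j w.
have fmY : fm Y.
  apply: finite_momentsM; last exact: finite_moments_prod.
  rewrite (_ : (fun w => _) =
    (fun w => \prod_(j <- s1) (\1_(if j \in s1 then E j else set0) w : R)%:C)).
    apply: finite_moments_prod => j; case: ifPn => [/FE/measurable_F mE|_].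
      exact: finite_moments_indic.
    exact: finite_moments_indic.
  by apply/funext => w; apply: eq_big_seq => j ->.
have EY : cE Y = (\prod_(j <- s1) (fine (P (E j)))%:C) * \prod_(j <- s2) cE (Z j).
  exact: IH.
have event (A : set T) : F i A ->
    cE (fun w => (\1_A w : R)%:C * Y w) = cE (fun w => (\1_A w : R)%:C) * cE Y.
  move=> FA; pose E' j := if j == i then A else E j.
  have E's j : j \in s1 -> E' j = E j.
    by rewrite /E'; case: eqP => // ->; rewrite (negbTE i1).
  have E'i : E' i = A by rewrite /E' eqxx.
  transitivity (cE (fun w => (\prod_(j <- i :: s1) (\1_(E' j) w : R)%:C) * \prod_(j <- s2) Z j w)).
    congr cexpectation; apply/funext => w; rewrite big_cons E'i /Y mulrA.
    by congr (_ * _ * _); apply: eq_big_seq => j /E's ->.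
  rewrite IH//; last by move=> j; rewrite inE => /predU1P[->|js1]; rewrite ?E'i// E's//; exact: FE.
  rewrite big_cons E'i EY (cexpectation_indic _ (measurable_F FA)) mulrA.
  by congr (_ * _ * _); apply: eq_big_seq => j /E's ->.
have -> : (fun w => (\prod_(j <- s1) (\1_(E j) w : R)%:C) * \prod_(j <- i :: s2) Z j w)
   = (fun w => Z i w * Y w).
  by apply/funext => w; rewrite big_cons mulrCA.
have indE (f : T -> R) (B : set R) w : (\1_B (f w) : R) = \1_(f @^-1` B) w.
  by rewrite !indicE; congr (nat_of_bool _)%:R; apply/idP/idP; rewrite !inE.
have event_of (f : T -> R) (B : set R) : F i (f @^-1` B) ->
    cE (fun w => (\1_B (f w) : R)%:C * Y w) = cE (fun w => (\1_B (f w) : R)%:C) * cE Y.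
  move=> /event; rewrite (_ : (fun w => (\1_(f @^-1` B) w)%:C) = fun w => (\1_B (f w))%:C).
    by move=> <-; congr cexpectation; apply/funext => w; rewrite indE.
  by apply/funext => w; rewrite indE.
rewrite cexpectationM_of_events// => [|B mB|B mB].
- by rewrite EY big_cons mulrCA.
- by have [FB _] := adapted_Z i mB; exact: event_of FB.
- by have [_ FB] := adapted_Z i mB; exact: event_of FB.
Qed.

Lemma cexpectation_prod_independent (s : seq I) : uniq s ->
  cE (fun w => \prod_(i <- s) Z i w) = \prod_(i <- s) cE (Z i).
Proof.
move=> us; have := @cexpectation_indic_prodM s [::] (fun=> set0) us.
rewrite big_nil mul1r => <-//.
by congr cexpectation; apply/funext => w; rewrite big_nil mul1r.
Qed.
End independent_products.

(** * Mixed moments of linear forms in independent inputs *)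

Lemma binomial_two_forms (S : comPzRingType) (x u v y z : S) p q :
  (u * x + y) ^+ p * (v * x + z) ^+ q =
  \sum_(a < p.+1) \sum_(b < q.+1) ('C(p, a)%:R * 'C(q, b)%:R * u ^+ a * v ^+ b) *
    (x ^+ (a + b) * (y ^+ (p - a) * z ^+ (q - b))).
Proof.
rewrite [_ * x + _]addrC [v * _ + _]addrC !exprDn big_distrlr /=.
apply: eq_bigr => a _; apply: eq_bigr => b _.
rewrite -mulr_natl -[X in _ * X]mulr_natl !exprMn exprD; ring.
Qed.

Section linear_forms.
Context d (T : measurableType d) (R : realType) (P : probability T R).
Local Notation C := R[i].
Local Notation cE := (cexpectation P).
Local Notation fm := (finite_moments P).
Variable l : nat -> {RV P >-> R}.
Hypothesis bounded_l : uniformly_bounded_moments P l.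
Hypothesis independent_l : independent_RVs P l.

Definition linear_form (w : nat -> C) (s : seq nat) (t : T) : C :=
  \sum_(i <- s) w i * (l i t)%:C.

Definition moment (i a : nat) : C := cE (fun t => (l i t)%:C ^+ a).

Definition form_moment (w : nat -> C) (s : seq nat) (p q : nat) : C :=
  cE (fun t => linear_form w s t ^+ p * Num.conj (linear_form w s t) ^+ q).

Lemma finite_moments_input i : fm (fun t => (l i t)%:C).
Proof.
split=> [||m]; [exact: measurable_funPT|exact: measurable_cst|].
have [B HB] := bounded_l m; apply: le_lt_trans (ltry B).
rewrite (_ : (fun w => _) = fun w => `|l i w| ^+ m)//.
by apply/funext => w /=; rewrite expr0n addr0 sqrtr_sqr.
Qed.
Hint Resolve finite_moments_input : core.

Lemma finite_moments_linear_form w s : fm (linear_form w s).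
Proof.
apply: finite_moments_sum => i; apply: finite_momentsM => //.
exact: finite_moments_cst.
Qed.
Hint Resolve finite_moments_linear_form : core.

Lemma finite_moments_form w s p q :
  fm (fun t => linear_form w s t ^+ p * Num.conj (linear_form w s t) ^+ q).
Proof.
by apply: finite_momentsM; apply: finite_momentsX => //; exact: finite_moments_conj.
Qed.
Hint Resolve finite_moments_form : core.

Lemma conj_real_complex (x : R) : Num.conj (x%:C) = x%:C.
Proof. by apply/eqP; rewrite eq_complex /= oppr0 !eqxx. Qed.

Lemma linear_form_cons w i s t :
  linear_form w (i :: s) t = w i * (l i t)%:C + linear_form w s t.
Proof. by rewrite /linear_form big_cons. Qed.

Lemma linear_form_perm w s s' : perm_eq s s' -> linear_form w s = linear_form w s'.
Proof. by move=> ss'; apply/funext => t; exact: perm_big. Qed.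

Lemma form_momentC w s p q : form_moment w s q p = Num.conj (form_moment w s p q).
Proof.
rewrite /form_moment -cexpectation_conj//; congr cexpectation; apply/funext => t.
by rewrite rmorphM !rmorphXn /= conjCK mulrC.
Qed.

Lemma form_moment0 w s : form_moment w s 0 0 = 1.
Proof.
rewrite /form_moment (_ : (fun _ => _) = fun=> 1) ?cexpectation_cst//.
by apply/funext => t; rewrite !expr0 mulr1.
Qed.

Lemma moment0 i : moment i 0 = 1.
Proof.
rewrite /moment (_ : (fun _ => _) = fun=> 1) ?cexpectation_cst//.
Qed.

Lemma form_cons w i s p q t :
  linear_form w (i :: s) t ^+ p * Num.conj (linear_form w (i :: s) t) ^+ q =
  \sum_(a < p.+1) \sum_(b < q.+1)
    ('C(p, a)%:R * 'C(q, b)%:R * w i ^+ a * Num.conj (w i) ^+ b) *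
    ((l i t)%:C ^+ (a + b) * (linear_form w s t ^+ (p - a) *
      Num.conj (linear_form w s t) ^+ (q - b))).
Proof.
by rewrite linear_form_cons rmorphD rmorphM /= conj_real_complex binomial_two_forms.
Qed.

Lemma cexpectation_sum2 p q (G : 'I_p -> 'I_q -> T -> C) (c : 'I_p -> 'I_q -> C) :
  (forall a b, fm (G a b)) ->
  cE (fun t => \sum_(a < p) \sum_(b < q) c a b * G a b t) =
  \sum_(a < p) \sum_(b < q) c a b * cE (G a b).
Proof.
move=> fG.
have fcG a b : fm (fun t => c a b * G a b t).
  by apply: finite_momentsM => //; exact: finite_moments_cst.
rewrite cexpectation_sum; last by move=> a; exact: finite_moments_sum.
apply: eq_bigr => a _; rewrite cexpectation_sum//.
by apply: eq_bigr => b _; rewrite cexpectationZ.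
Qed.

Lemma cexpectation_monomial (J : seq nat) (e : nat -> nat) : uniq J ->
  cE (fun t => \prod_(i <- J) (l i t)%:C ^+ e i) = \prod_(i <- J) moment i (e i).
Proof.
apply: (cexpectation_prod_independent (F := fun i => g_sigma_algebra_preimage (l i))).
- move=> i A [B mB <-]; rewrite setTI -[_ @^-1` _]setTI.
  exact: measurable_funPT.
- exact: independent_l.
- by move=> i; exact: finite_momentsX.
move=> i B mB; split.
  exists ((fun x : R => x ^+ e i) @^-1` B); last first.
    rewrite setTI; apply/seteqP; split => t /=; rewrite -rmorphXn//=.
  by rewrite -[X in measurable X]setTI; apply: measurable_funX.
exists ((fun x : R => 0) @^-1` B); last first.
  by rewrite setTI; apply/seteqP; split => t /=; rewrite -rmorphXn//=.
by rewrite -[X in measurable X]setTI; apply: measurable_cst.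
Qed.

(** A linear form in some inputs is uncorrelated with the other inputs; the
    form is peeled off input by input, which only uses independence of the
    family of inputs. *)
Lemma form_moment_factor w s J e p q : uniq (J ++ s) ->
  cE (fun t => (\prod_(i <- J) (l i t)%:C ^+ e i) *
    (linear_form w s t ^+ p * Num.conj (linear_form w s t) ^+ q)) =
  (\prod_(i <- J) moment i (e i)) * form_moment w s p q.
Proof.
elim: s J e p q => [|m s IH] J e p q us.
  have E t : linear_form w [::] t ^+ p * Num.conj (linear_form w [::] t) ^+ q =
      0 ^+ p * Num.conj 0 ^+ q.
    by rewrite /linear_form big_nil.
  rewrite /form_moment (funext E) cexpectation_cst mulrC -cexpectation_monomial; last first.
    by rewrite cats0 in us.
  rewrite -cexpectationZ; last by apply: finite_moments_prod => i; exact: finite_momentsX.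
  by congr cexpectation; apply/funext => t; rewrite mulrC E.
have /andP[mJs uJs] : uniq (m :: J ++ s) by rewrite -[_ :: _]cat1s uniq_catCA.
have us0 : uniq (m :: s) by move: us; rewrite cat_uniq => /and3P[].
have mJ : m \notin J by apply: contra mJs; rewrite mem_cat => ->.
have expand J' e' : uniq (m :: J' ++ s) ->
  cE (fun t => (\prod_(i <- J') (l i t)%:C ^+ e' i) *
    (linear_form w (m :: s) t ^+ p * Num.conj (linear_form w (m :: s) t) ^+ q)) =
  (\prod_(i <- J') moment i (e' i)) * \sum_(a < p.+1) \sum_(b < q.+1)
    ('C(p, a)%:R * 'C(q, b)%:R * w m ^+ a * Num.conj (w m) ^+ b) *
    (moment m (a + b) * form_moment w s (p - a) (q - b)).
  move=> uJ'; have mJ' : m \notin J'.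
    by apply/negP => mJ'; move: uJ'; rewrite /= mem_cat mJ'.
  pose G (a b : nat) t := (\prod_(i <- J') (l i t)%:C ^+ e' i) *
    ((l m t)%:C ^+ (a + b) * (linear_form w s t ^+ (p - a) *
      Num.conj (linear_form w s t) ^+ (q - b))).
  transitivity (cE (fun t => \sum_(a < p.+1) \sum_(b < q.+1)
      ('C(p, a)%:R * 'C(q, b)%:R * w m ^+ a * Num.conj (w m) ^+ b) * G a b t)).
    congr cexpectation; apply/funext => t; rewrite form_cons mulr_sumr.
    apply: eq_bigr => a _; rewrite mulr_sumr; apply: eq_bigr => b _.
    by rewrite mulrCA.
  rewrite cexpectation_sum2; last first.
    move=> a b; apply: finite_momentsM.
      by apply: finite_moments_prod => i; exact: finite_momentsX.
    by apply: finite_momentsM => //; exact: finite_momentsX.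
  rewrite mulr_sumr; apply: eq_bigr => a _; rewrite mulr_sumr; apply: eq_bigr => b _.
  rewrite [RHS]mulrCA; congr (_ * _).
  (* The power of the input m joins the monomial already split off. *)
pose e'' i := if i == m then (a + b)%N else e' i.
  have e''E i : i \in J' -> e'' i = e' i.
    by move=> iJ; rewrite /e''; case: eqP => // im; rewrite -im iJ in mJ'.
  transitivity (cE (fun t => (\prod_(i <- m :: J') (l i t)%:C ^+ e'' i) *
     (linear_form w s t ^+ (p - a) * Num.conj (linear_form w s t) ^+ (q - b)))).
    congr cexpectation; apply/funext => t; rewrite big_cons {1}/e'' eqxx /G mulrCA mulrA.
    by congr (_ * _ * _); apply: eq_big_seq => i /e''E ->.
  rewrite IH// big_cons {1}/e'' eqxx mulrCA mulrA.
  by congr (_ * _ * _); apply: eq_big_seq => i /e''E ->.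
rewrite expand//= ?mJs//; congr (_ * _).
have := expand [::] e us0; rewrite big_nil mul1r => <-.
by congr cexpectation; apply/funext => t; rewrite big_nil mul1r.
Qed.

(** Conditioning on the input [m] in a purely algebraic way: the powers of the
    input separate from the form in the remaining inputs. *)
Lemma form_moment_expand w m s c p q : uniq (m :: s) ->
  cE (fun t => (l m t)%:C ^+ c *
    (linear_form w (m :: s) t ^+ p * Num.conj (linear_form w (m :: s) t) ^+ q)) =
  \sum_(a < p.+1) \sum_(b < q.+1)
    ('C(p, a)%:R * 'C(q, b)%:R * w m ^+ a * Num.conj (w m) ^+ b) *
    (moment m (c + (a + b)) * form_moment w s (p - a) (q - b)).
Proof.
move=> us.
pose G (a b : nat) t := (l m t)%:C ^+ (c + (a + b)) * (linear_form w s t ^+ (p - a) *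
      Num.conj (linear_form w s t) ^+ (q - b)).
transitivity (cE (fun t => \sum_(a < p.+1) \sum_(b < q.+1)
    ('C(p, a)%:R * 'C(q, b)%:R * w m ^+ a * Num.conj (w m) ^+ b) * G a b t)).
  congr cexpectation; apply/funext => t; rewrite form_cons mulr_sumr.
  apply: eq_bigr => a _; rewrite mulr_sumr; apply: eq_bigr => b _.
  by rewrite mulrCA; congr (_ * _); rewrite /G (exprD _ c) -[RHS]mulrA.
rewrite cexpectation_sum2; last first.
  by move=> a b; apply: finite_momentsM => //; exact: finite_momentsX.
apply: eq_bigr => a _; apply: eq_bigr => b _; congr (_ * _).
have := @form_moment_factor w s [:: m] (fun=> c + (a + b))%N (p - a) (q - b) us.
rewrite big_seq1 => <-.
by congr cexpectation; apply/funext => t; rewrite big_seq1.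
Qed.

Lemma form_moment_remove w m s p q : uniq s -> m \in s ->
  form_moment w s p q = \sum_(a < p.+1) \sum_(b < q.+1)
    ('C(p, a)%:R * 'C(q, b)%:R * w m ^+ a * Num.conj (w m) ^+ b) *
    (moment m (a + b) * form_moment w (rem m s) (p - a) (q - b)).
Proof.
move=> us ms; have ps := perm_to_rem ms.
rewrite /form_moment (linear_form_perm w ps).
have um : uniq (m :: rem m s) by rewrite -(perm_uniq ps).
have := form_moment_expand w 0 p q um => <-.
by congr cexpectation; apply/funext => t; rewrite expr0 mul1r.
Qed.

(** The first factor of the power is expanded over the inputs; each input is
    then made explicit in the remaining factors too. *)
Lemma form_momentS w s p q : uniq s ->
  form_moment w s p.+1 q = \sum_(m <- s) w m * \sum_(a < p.+1) \sum_(b < q.+1)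
    ('C(p, a)%:R * 'C(q, b)%:R * w m ^+ a * Num.conj (w m) ^+ b) *
    (moment m (a + b).+1 * form_moment w (rem m s) (p - a) (q - b)).
Proof.
move=> us.
pose G m t := (l m t)%:C ^+ 1 *
   (linear_form w s t ^+ p * Num.conj (linear_form w s t) ^+ q).
have fG m : fm (G m) by apply: finite_momentsM => //; exact: finite_momentsX.
transitivity (cE (fun t => \sum_(m <- s) w m * G m t)).
  congr cexpectation; apply/funext => t; rewrite exprS -mulrA.
  rewrite {1}/linear_form mulr_suml; apply: eq_bigr => m _.
  by rewrite /G expr1 -[LHS]mulrA.
rewrite cexpectation_sum; last first.
  by move=> m; apply: finite_momentsM => //; exact: finite_moments_cst.
apply: eq_big_seq => m ms; have ps := perm_to_rem ms.
have um : uniq (m :: rem m s) by rewrite -(perm_uniq ps).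
rewrite cexpectationZ//; congr (_ * _).
have := form_moment_expand w 1 p q um => <-.
by rewrite /G (linear_form_perm w ps).
Qed.
End linear_forms.

(** * Gaussian approximation of linear forms *)

Section binomial_sums.
Variable C : numClosedFieldType.

Lemma sum_binomial (p : nat) : \sum_(a < p.+1) 'C(p, a)%:R = 2 ^+ p :> C.
Proof.
rewrite (_ : 2 = 1 + 1)// exprDn; apply: eq_bigr => a _.
by rewrite !expr1n mulr1.
Qed.

Lemma binomial_sum2_le p q (x : nat -> nat -> C) (X : C) :
  (forall a b, (a <= p)%N -> (b <= q)%N -> `|x a b| <= X) ->
  `|\sum_(a < p.+1) \sum_(b < q.+1) 'C(p, a)%:R * 'C(q, b)%:R * x a b| <= 2 ^+ (p + q) * X.
Proof.
move=> xX; rewrite exprD -!sum_binomial big_distrlr /= mulr_suml.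
apply: (le_trans (ler_norm_sum _ _ _)); apply: ler_sum => a _.
rewrite mulr_suml; apply: (le_trans (ler_norm_sum _ _ _)); apply: ler_sum => b _.
rewrite !normrM !normr_nat; apply: ler_wpM2l; first by rewrite mulr_ge0.
by apply: xX; rewrite -ltnS ltn_ord.
Qed.

Lemma binomial_sum_low p (F : nat -> C) : (forall a, (2 <= a)%N -> F a = 0) ->
  \sum_(a < p.+1) 'C(p, a)%:R * F a = F 0%N + p%:R * F 1%N.
Proof.
move=> F0; case: p => [|p].
  by rewrite big_ord_recl big_ord0 bin0 mul1r mul0r.
rewrite 2!big_ord_recl big1 ?addr0 => [|a _]; last by rewrite F0 ?mulr0.
by rewrite bin0 bin1 mul1r.
Qed.

(** The terms of degree at most one involve prescribed moments of the inputs
    only, and are kept exactly; the others will be errors of higher order in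
    the coefficients. *)
Lemma binomial_sum2_low p q (x : nat -> nat -> C) :
  \sum_(a < p.+1) \sum_(b < q.+1) 'C(p, a)%:R * 'C(q, b)%:R * x a b =
  x 0%N 0%N + p%:R * x 1%N 0%N + q%:R * x 0%N 1%N +
  \sum_(a < p.+1) \sum_(b < q.+1) 'C(p, a)%:R * 'C(q, b)%:R *
    (if (2 <= a + b)%N then x a b else 0).
Proof.
pose y a b := if (2 <= a + b)%N then 0 else x a b.
transitivity (\sum_(a < p.+1) 'C(p, a)%:R * (\sum_(b < q.+1) 'C(q, b)%:R * y a b) +
  \sum_(a < p.+1) \sum_(b < q.+1) 'C(p, a)%:R * 'C(q, b)%:R *
    (if (2 <= a + b)%N then x a b else 0)).
  rewrite -big_split; apply: eq_bigr => a _; rewrite mulr_sumr -big_split /=.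
  apply: eq_bigr => b _; rewrite /y mulrA -mulrDr; congr (_ * _).
  by case: ifP; rewrite ?addr0 ?add0r.
congr (_ + _).
have yq a : \sum_(b < q.+1) 'C(q, b)%:R * y a b = y a 0%N + q%:R * y a 1%N.
  by apply: (@binomial_sum_low q (y a)) => b b2; rewrite /y (leq_trans b2)// leq_addl.
under eq_bigr do rewrite yq.
rewrite (@binomial_sum_low p (fun a => y a 0%N + q%:R * y a 1%N)).
  by rewrite /y /= mulr0 addr0 addrAC.
by move=> a a2; rewrite /y addn0 addn1 a2 leqW// mulr0 addr0.
Qed.
End binomial_sums.

Section gaussian_approximation.
Variable C : numClosedFieldType.

(** The relations between the mixed moments [M s p q], of degree [p] in the
    linear form over the inputs in [s] and [q] in its conjugate, from which the
    Gaussian approximation follows without further probability theory; [w] are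
    the coefficients and [mu] the moments of the inputs. *)
Record moment_system (w : nat -> C) (mu : nat -> nat -> C)
    (M : seq nat -> nat -> nat -> C) : Prop := MomentSystem {
  moment_system0 : forall s, M s 0%N 0%N = 1;
  moment_systemC : forall s p q, M s q p = Num.conj (M s p q);
  moment_system_rem : forall s m p q, uniq s -> m \in s ->
    M s p q = \sum_(a < p.+1) \sum_(b < q.+1)
      ('C(p, a)%:R * 'C(q, b)%:R * w m ^+ a * Num.conj (w m) ^+ b) *
      (mu m (a + b)%N * M (rem m s) (p - a)%N (q - b)%N);
  moment_systemS : forall s p q, uniq s ->
    M s p.+1 q = \sum_(m <- s) w m * \sum_(a < p.+1) \sum_(b < q.+1)
      ('C(p, a)%:R * 'C(q, b)%:R * w m ^+ a * Num.conj (w m) ^+ b) *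
      (mu m (a + b).+1%N * M (rem m s) (p - a)%N (q - b)%N) }.

Record standard_moments (B : nat -> C) (mu : nat -> nat -> C) : Prop :=
  StandardMoments {
  standard_moments0 : forall m, mu m 0%N = 1;
  standard_moments1 : forall m, mu m 1%N = 0;
  standard_moments2 : forall m, mu m 2%N = 1;
  standard_moments_le : forall m a, `|mu m a| <= B a }.

Variable B : nat -> C.
Hypothesis B_ge0 : forall a, 0 <= B a.

Let Bmax r := \sum_(a < r.+3) B a.
Let Bmax_ge0 r : 0 <= Bmax r. Proof. exact: sumr_ge0. Qed.
Let le_Bmax a r : (a <= r.+2)%N -> B a <= Bmax r.
Proof.
move=> ar; rewrite /Bmax (bigD1 (Ordinal (ar : a < r.+3)%N)) //= lerDl.
exact: sumr_ge0.
Qed.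

Let term_le (z h u v U V : C) a b c : `|z| = h -> h <= 1 -> (c <= a + b)%N ->
  `|u| <= U -> `|v| <= V -> `|z ^+ a * (Num.conj z ^+ b * (u * v))| <= h ^+ c * (U * V).
Proof.
move=> zh h1 cab uU vV; have h0 : 0 <= h by rewrite -zh.
rewrite !normrM !normrX norm_conjC zh mulrA -exprD.
apply: ler_pM => //; first by rewrite exprn_ge0.
  exact: ler_wiXn2l.
exact: ler_pM.
Qed.

Let norm_sum_le (s : seq nat) (f : nat -> C) (X : C) :
  (forall m, m \in s -> `|f m| <= X) -> `|\sum_(m <- s) f m| <= (size s)%:R * X.
Proof.
move=> fX; apply: (le_trans (ler_norm_sum _ _ _)).
rewrite big_seq; apply: (@le_trans _ _ (\sum_(m <- s | m \in s) X)); first exact: ler_sum.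
by rewrite -big_seq big_const_seq count_predT iter_addr_0 mulr_natl.
Qed.

Let size_rem_le (s : seq nat) m (h : C) : 0 <= h -> (size s)%:R * h ^+ 2 <= 1 ->
  (size (rem m s))%:R * h ^+ 2 <= 1.
Proof.
move=> h0; apply: le_trans; apply: ler_wpM2r; first exact: exprn_ge0.
by rewrite ler_nat; apply: size_subseq; exact: rem_subseq.
Qed.

(** Induction on the degree.  The selected input has mean zero, so it occurs at
    least twice, which costs h^2 for each of the at most h^-2 inputs. *)
Lemma form_moment_bounded r : exists2 K : C, 1 <= K &
  forall w mu M (h : C) s p q, moment_system w mu M -> standard_moments B mu ->
    (forall m, `|w m| = h) -> h <= 1 -> (size s)%:R * h ^+ 2 <= 1 -> uniq s ->
    (p + q <= r)%N -> `|M s p q| <= K.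
Proof.
elim: r => [|r [K K1 IH]].
  exists 1 => // w mu M h s p q [M0 _ _ _] _ _ _ _ _.
  by rewrite leqn0 addn_eq0 => /andP[/eqP-> /eqP->]; rewrite M0 normr1.
have K0 : 0 <= K by apply: le_trans K1.
have Q0 : 0 <= 2 ^+ r * (Bmax r * K) by rewrite mulr_ge0 ?exprn_ge0// mulr_ge0.
exists (2 ^+ r * (Bmax r * K) + K); first by rewrite (le_trans K1)// lerDr.
move=> w mu M h s p q sys std wh h1 sh us pqr.
have h0 : 0 <= h by rewrite -(wh 0%N).
have step p' q' : (p' + q' <= r)%N -> `|M s p'.+1 q'| <= 2 ^+ r * (Bmax r * K).
  move=> pq'; rewrite (moment_systemS sys)//.
  apply: (@le_trans _ _ ((size s)%:R * (h ^+ 2 * (2 ^+ r * (Bmax r * K))))); last first.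
    by rewrite mulrA -[leRHS]mul1r ler_wpM2r.
  apply: norm_sum_le => m ms; rewrite normrM wh expr2 -mulrA; apply: ler_wpM2l => //.
  under eq_bigr do under eq_bigr do rewrite -!mulrA mulrA.
  pose x a b := w m ^+ a * (Num.conj (w m) ^+ b *
    (mu m (a + b).+1%N * M (rem m s) (p' - a)%N (q' - b)%N)).
  apply: (@le_trans _ _ (2 ^+ (p' + q') * (h * (Bmax r * K)))); last first.
    rewrite mulrCA; apply: ler_wpM2l => //; apply: ler_wpM2r; first by rewrite mulr_ge0.
    by rewrite ler_eXn2l// ltr1n.
  apply: (@binomial_sum2_le _ _ _ x) => a b ap bq.
  rewrite /x; have [ab0|ab0] := eqVneq (a + b)%N 0%N.
    by rewrite ab0 (standard_moments1 std) mul0r !mulr0 normr0 !mulr_ge0.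
  rewrite -[h in leRHS]expr1; apply: term_le => //; first by rewrite lt0n.
    by apply: (le_trans (standard_moments_le std _ _)); by apply: le_Bmax; rewrite ltnS leqW// (leq_trans (leq_add ap bq)).
  apply: (IH w mu M h) => //; [exact: size_rem_le|exact: rem_uniq|].
  exact: leq_trans (leq_add (leq_subr a p') (leq_subr b q')) pq'.
case: p pqr => [|p] pqr; last first.
  by apply: (le_trans (step p q _)) => //; rewrite lerDl.
case: q pqr => [|q] pqr.
  rewrite (moment_system0 sys) normr1 (le_trans K1)// lerDr//.
rewrite (moment_systemC sys) norm_conjC (le_trans (step q 0%N _)) ?lerDl//.
by rewrite addn0.
Qed.

(** Dropping one input is an O(h^2) perturbation, again because that input has
    to occur twice. *)
Lemma form_moment_stable r : exists2 K : C, 0 <= K &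
  forall w mu M (h : C) s m p q, moment_system w mu M -> standard_moments B mu ->
    (forall m, `|w m| = h) -> h <= 1 -> (size s)%:R * h ^+ 2 <= 1 -> uniq s ->
    m \in s -> (p + q <= r)%N -> `|M (rem m s) p q - M s p q| <= K * h ^+ 2.
Proof.
have [K K1 bound] := form_moment_bounded r; have K0 : 0 <= K by apply: le_trans K1.
exists (2 ^+ r * (Bmax r * K)); first by rewrite mulr_ge0 ?exprn_ge0// mulr_ge0.
move=> w mu M h s m p q sys std wh h1 sh us ms pqr.
have h0 : 0 <= h by rewrite -(wh 0%N).
rewrite [M s p q](moment_system_rem sys _ _ us ms) distrC.
under eq_bigr do under eq_bigr do rewrite -!mulrA mulrA.
pose x a b := w m ^+ a * (Num.conj (w m) ^+ b *
  (mu m (a + b)%N * M (rem m s) (p - a)%N (q - b)%N)).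
rewrite (binomial_sum2_low p q x) {1 2 3}/x !(standard_moments1 std) (standard_moments0 std).
rewrite !expr0 !mul1r !subn0 !(mul0r, mulr0) !addr0 addrC addrA addNr add0r.
apply: (@le_trans _ _ (2 ^+ (p + q) * (h ^+ 2 * (Bmax r * K)))); last first.
  rewrite -[leRHS]mulrA [Bmax r * K * _]mulrC; apply: ler_wpM2r.
    by rewrite !mulr_ge0 ?exprn_ge0.
  by rewrite ler_eXn2l// ltr1n.
apply: (@binomial_sum2_le _ _ _ (fun a b => if (2 <= a + b)%N then x a b else 0)) => a b ap bq.
case: ifPn => ab; last by rewrite normr0 !mulr_ge0// exprn_ge0.
apply: term_le => //.
  by apply: (le_trans (standard_moments_le std _ _)); by apply: le_Bmax; rewrite !leqW// (leq_trans (leq_add ap bq)).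
apply: (bound w mu M h) => //; [exact: size_rem_le|exact: rem_uniq|].
exact: leq_trans (leq_add (leq_subr a p) (leq_subr b q)) pqr.
Qed.

(** Gaussian integration by parts, up to an error of the size of a single
    coefficient: the selected input pairs with one of the [p] forms, with total
    weight the sum of the squares [w m ^+ 2], or with one of the [q] conjugate
    forms, with total weight 1. *)
Lemma form_moment_by_parts r : exists2 K : C, 0 <= K &
  forall w mu M (h : C) s p q, moment_system w mu M -> standard_moments B mu ->
    (forall m, `|w m| = h) -> h <= 1 -> (size s)%:R * h ^+ 2 = 1 -> uniq s ->
    \sum_(m <- s) w m ^+ 2 = 0 -> (p + q <= r)%N ->
    `|M s p.+1 q - q%:R * M s p q.-1| <= K * h.
Proof.
have [K K1 bound] := form_moment_bounded r; have K0 : 0 <= K by apply: le_trans K1.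
have [L L0 stable] := form_moment_stable r.
exists (r%:R * L + r%:R * L + 2 ^+ r * (Bmax r * K)).
  by rewrite !addr_ge0 ?mulr_ge0 ?exprn_ge0// mulr_ge0.
move=> w mu M h s p q sys std wh h1 sh us w2 pqr.
have h0 : 0 <= h by rewrite -(wh 0%N).
have sh1 : (size s)%:R * h ^+ 2 <= 1 by rewrite sh.
have h2 : h ^+ 2 <= h by rewrite -[leRHS]expr1 ler_wiXn2l.
(* The contribution of the input m that occurs exactly twice, with the
   moments of the full form in place of those of the form without m. *)
pose G m := p%:R * w m ^+ 2 * M s p.-1 q + q%:R * h ^+ 2 * M s p q.-1.
have sumG : \sum_(m <- s) G m = q%:R * M s p q.-1.
  rewrite big_split /= -mulr_suml -mulr_sumr w2 mulr0 mul0r add0r.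
  rewrite big_const_seq count_predT iter_addr_0 -mulr_natl.
  transitivity ((size s)%:R * h ^+ 2 * (q%:R * M s p q.-1)); first by ring.
  by rewrite sh mul1r mulr1.
rewrite (moment_systemS sys)// -sumG -sumrB.
set K' := _ + _ * (_ * K).
apply: (@le_trans _ _ ((size s)%:R * (h ^+ 2 * (K' * h)))); last by rewrite mulrA sh mul1r.
apply: norm_sum_le => m ms; rewrite {}/K'.
under eq_bigr do under eq_bigr do rewrite -!mulrA mulrA.
pose x a b := w m ^+ a * (Num.conj (w m) ^+ b *
  (mu m (a + b).+1%N * M (rem m s) (p - a)%N (q - b)%N)).
rewrite (binomial_sum2_low p q x) {1 2 3}/x (standard_moments1 std) !(standard_moments2 std).
rewrite !expr0 !expr1 !mul1r !subn0 !subn1 !(mul0r, mulr0) !add0r.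
set rest := \sum_(a < _) _; set M' := M (rem m s).
have wc : w m * Num.conj (w m) = h ^+ 2 by rewrite -normCK wh.
have -> : w m * (p%:R * (w m * M' p.-1 q) + q%:R * (Num.conj (w m) * M' p q.-1) + rest) - G m
  = p%:R * w m ^+ 2 * (M' p.-1 q - M s p.-1 q) + q%:R * h ^+ 2 * (M' p q.-1 - M s p q.-1)
    + w m * rest.
  by rewrite /G -wc; ring.
have restle : `|rest| <= 2 ^+ r * (Bmax r * K) * h ^+ 2.
  apply: (@le_trans _ _ (2 ^+ (p + q) * (h ^+ 2 * (Bmax r * K)))); last first.
    rewrite -[leRHS]mulrA [Bmax r * K * _]mulrC; apply: ler_wpM2r.
      by rewrite !mulr_ge0 ?exprn_ge0.
    by rewrite ler_eXn2l// ltr1n.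
  apply: (@binomial_sum2_le _ _ _ (fun a b => if (2 <= a + b)%N then x a b else 0)) => a b ap bq.
  case: ifPn => ab; last by rewrite normr0 !mulr_ge0// exprn_ge0.
  apply: term_le => //.
    by apply: (le_trans (standard_moments_le std _ _)); by apply: le_Bmax; rewrite ltnS leqW// (leq_trans (leq_add ap bq)).
  apply: (bound w mu M h) => //; [exact: size_rem_le|exact: rem_uniq|].
  exact: leq_trans (leq_add (leq_subr a p) (leq_subr b q)) pqr.
have st p' q' : (p' + q' <= r)%N -> `|M' p' q' - M s p' q'| <= L * h.
  move=> pq'; apply: (le_trans (stable w mu M h s m p' q' sys std wh h1 sh1 us ms pq')).
  exact: ler_wpM2l.
rewrite mulrDl mulrDr; apply: (le_trans (ler_normD _ _)).
have pr := leq_trans (leq_addr q p) pqr.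
have qr := leq_trans (leq_addl p q) pqr.
apply: lerD.
  rewrite mulrDl mulrDr; apply: (le_trans (ler_normD _ _)).
  have small (c : nat) (z D : C) : (c <= r)%N -> `|z| = h ^+ 2 -> `|D| <= L * h ->
      `|c%:R * z * D| <= r%:R * L * h * h ^+ 2.
    move=> cr zh Dh; rewrite normrM (normrM c%:R) normr_nat zh mulrAC.
    apply: ler_wpM2r; first exact: exprn_ge0.
    by rewrite -mulrA; apply: ler_pM; rewrite ?ler_nat.
  rewrite (mulrC (h ^+ 2)); apply: lerD; apply: small => //.
  - by rewrite normrX wh.
  - exact/st/(leq_trans (leq_add (leq_pred p) (leqnn q)) pqr).
  - by rewrite normrX (ger0_norm h0).
  - exact/st/(leq_trans (leq_add (leqnn p) (leq_pred q)) pqr).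
rewrite normrM wh; apply: (@le_trans _ _ (h * (2 ^+ r * (Bmax r * K) * h ^+ 2))).
  exact: ler_wpM2l.
by rewrite mulrCA [h * h ^+ 2]mulrC mulrCA.
Qed.

(** The moment E Z^p conj(Z)^q of a standard complex Gaussian variable Z, whose
    modulus is Rayleigh distributed. *)
Definition rayleigh_moment p q : C := if p == q then (p`!)%:R else 0.

(** The moments E Z^p conj(Z)^q of a standard complex Gaussian variable satisfy
    the exact version of the recursion of [form_moment_by_parts]. *)
Lemma form_moment_gaussian r : exists2 K : C, 0 <= K &
  forall w mu M (h : C) s p q, moment_system w mu M -> standard_moments B mu ->
    (forall m, `|w m| = h) -> h <= 1 -> (size s)%:R * h ^+ 2 = 1 -> uniq s ->
    \sum_(m <- s) w m ^+ 2 = 0 -> (p + q <= r)%N ->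
    `|M s p q - rayleigh_moment p q| <= K * h.
Proof.
elim: r => [|r [K K0 IH]].
  exists 0 => // w mu M h s p q [M0 _ _ _] _ _ _ _ _ _.
  rewrite leqn0 addn_eq0 => /andP[/eqP-> /eqP->].
  by rewrite M0 /rayleigh_moment eqxx fact0 subrr normr0 mul0r.
have [L L0 parts] := form_moment_by_parts r.
exists (L + r%:R * K + K); first by rewrite !addr_ge0 ?mulr_ge0.
move=> w mu M h s p q sys std wh h1 sh us w2 pqr.
have h0 : 0 <= h by rewrite -(wh 0%N).
have step p' q' : (p' + q' <= r)%N ->
    `|M s p'.+1 q' - rayleigh_moment p'.+1 q'| <= (L + r%:R * K) * h.
  move=> pq'; have := parts w mu M h s p' q' sys std wh h1 sh us w2 pq'.
  case: q' pq' => [|q'] pq' Lh.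
    rewrite mul0r subr0 in Lh; rewrite /rayleigh_moment subr0 (le_trans Lh)//.
    by apply: ler_wpM2r => //; rewrite lerDl mulr_ge0.
  have -> : rayleigh_moment p'.+1 q'.+1 = q'.+1%:R * rayleigh_moment p' q'.
    rewrite /rayleigh_moment eqSS; case: eqP => [->|_]; last by rewrite mulr0.
    by rewrite factS natrM.
  rewrite mulrDl; apply: (le_trans _ (lerD Lh (_ : q'.+1%:R * (K * h) <= _))); last first.
    by rewrite mulrA; apply: ler_wpM2r => //; apply: ler_wpM2r => //; rewrite ler_nat; lia.
  rewrite -[M s p'.+1 q'.+1 - _](subrKA (q'.+1%:R * M s p' q')).
  apply: (le_trans (ler_normD _ _)); apply: lerD => //.
  rewrite -mulrBr normrM normr_nat; apply: ler_wpM2l => //.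
  by apply: (IH w mu M h) => //; lia.
case: p pqr => [|p] pqr; last first.
  by apply: (le_trans (step p q _)) => //; apply: ler_wpM2r => //; rewrite lerDl.
case: q pqr => [|q] pqr.
  rewrite (moment_system0 sys) /rayleigh_moment eqxx fact0 subrr normr0.
  by rewrite mulr_ge0// !addr_ge0 ?mulr_ge0.
have -> : M s 0%N q.+1 - rayleigh_moment 0 q.+1 = Num.conj (M s q.+1 0%N - rayleigh_moment q.+1 0).
  by rewrite (moment_systemC sys) /rayleigh_moment !subr0.
rewrite norm_conjC; apply: (le_trans (step q 0%N _)); first by rewrite addn0.
by apply: ler_wpM2r => //; rewrite lerDl.
Qed.
End gaussian_approximation.

(** * Words in left skew-circulant matrices *)

Section roots_of_unity.
Variable C : numClosedFieldType.

Lemma prim_root_exists n : (0 < n)%N -> exists z : C, n.-primitive_root z.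
Proof.
move=> n_gt0; pose p : {poly C} := 'X^n - 1.
have [r Dp] := closed_field_poly_normal p.
rewrite (monicP _) ?monicXnsubC// scale1r in Dp.
have rn1 : all n.-unity_root r by apply/allP => z; rewrite -root_prod_XsubC -Dp.
have sz_r : (n < (size r).+1)%N by rewrite -(size_prod_XsubC r id) -Dp size_XnsubC.
have [|z] := hasP (has_prim_root n_gt0 rn1 _ sz_r); last by exists z.
by rewrite -separable_prod_XsubC -Dp separable_Xn_sub_1// pnatr_eq0 -lt0n.
Qed.

Lemma conj_unity_root n (z : C) : (0 < n)%N -> z ^+ n = 1 -> `|z| = 1 /\ Num.conj z = z^-1.
Proof.
move=> n0 zn; have z1 : `|z| = 1.
  by apply/eqP; rewrite -(pexpr_eq1 n0)// -normrX zn normr1.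
by split=> //; rewrite invC_norm z1 expr1n invr1 mul1r.
Qed.

Lemma geometric_sum_unity n (x : C) : x ^+ n = 1 -> x != 1 -> \sum_(i < n) x ^+ i = 0.
Proof.
move=> xn x1; have := subrX1 x n; rewrite xn subrr => /esym/eqP.
by rewrite mulf_eq0 subr_eq0 (negbTE x1) => /eqP.
Qed.
End roots_of_unity.

Section alternating_products.
Variables (C : numClosedFieldType) (k : nat).

Definition alternating_prod (x : 'I_k -> C) (s : seq 'I_k) : C :=
  foldr (fun j y => x j * Num.conj y) 1 s.

Lemma alternating_prodE x s : alternating_prod x s =
  \prod_j (x j ^+ parity_count true s j * Num.conj (x j) ^+ parity_count false s j).
Proof.
elim: s => [|i s IH] /=; first by rewrite big1// => j _; rewrite !expr0 mulr1.
rewrite IH rmorph_prod /=.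
have -> : x i = \prod_j x j ^+ (i == j).
  rewrite (bigD1 i) //= eqxx expr1 big1 ?mulr1// => j ji.
  by rewrite eq_sym (negbTE ji) expr0.
rewrite -big_split /=; apply: eq_bigr => j _.
by rewrite rmorphM !rmorphXn /= conjCK exprD add0n -mulrA [_ * x j ^+ _]mulrC.
Qed.
End alternating_products.

Section skew_circulant_words.
Variables (C : numClosedFieldType) (n k : nat) (z : C).
Hypothesis prim_z : (2 * n.+1).-primitive_root z.
Variable l : 'I_k -> nat -> C.
Hypothesis real_l : forall j m, Num.conj (l j m) = l j m.

(** The odd powers of a primitive 2N-th root of unity are the N-th roots of
    -1. *)
Definition freq (f : nat) : C := z ^+ (2 * f).+1.

Let z2n : z ^+ (2 * n.+1) = 1. Proof. exact: prim_expr_order. Qed.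

Lemma conj_freq f : `|freq f| = 1 /\ Num.conj (freq f) = (freq f)^-1.
Proof.
apply: (@conj_unity_root _ (2 * n.+1)) => //.
by rewrite /freq -exprM mulnC exprM z2n expr1n.
Qed.

Let freq_neq0 f : freq f != 0.
Proof. by rewrite -normr_gt0 (conj_freq f).1. Qed.

Lemma freqXn f : freq f ^+ n.+1 = -1.
Proof.
have zn : z ^+ n.+1 = -1.
  have : (z ^+ n.+1) ^+ 2 == 1 by rewrite -exprM mulnC z2n.
  rewrite sqrf_eq1 => /orP[|/eqP//].
  by rewrite -(prim_order_dvd prim_z) => /(dvdn_leq (ltn0Sn n)); lia.
by rewrite /freq -exprM mulnC exprM zn -signr_odd /= oddM /= expr1.
Qed.

(** The summand l_m omega^m is unchanged when m = i + i' is reduced modulo N,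
    the two sign changes cancelling each other. *)
Lemma lscirc_freq j f (i : 'I_n.+1) :
  \sum_i' lscirc n.+1 (l j) i i' * freq f ^+ i' =
  Num.conj (freq f) ^+ i * \sum_(m < n.+1) l j m * freq f ^+ m.
Proof.
apply: (mulfI (expf_neq0 i (freq_neq0 f))).
rewrite mulrA -exprMn (conj_freq f).2 divff// expr1n mul1r mulr_sumr.
rewrite [RHS](reindex_inj (addrI i)); apply: eq_bigr => i' _ /=.
rewrite mxE mulrCA -exprD.
have [lt|ge] := ltnP (i + i') n.+1; first by rewrite modn_small.
have -> : ((i + i') %% n.+1 = i + i' - n.+1)%N.
  rewrite -[X in (X %% _)%N](subnK ge) modnDr modn_small//.
  by rewrite ltn_subLR// -addnS leq_add// ltnW.
rewrite -{2}[(i + i')%N](subnK ge) exprD freqXn mulrN1 mulNr mulrN opprK//.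
Qed.

Lemma freq_orthogonal (i i' : 'I_n.+1) :
  \sum_(f < n.+1) Num.conj (freq f) ^+ i * freq f ^+ i' = n.+1%:R *+ (i == i').
Proof.
have [<-|ii'] := eqVneq i i'.
  under eq_bigr => f _ do rewrite -exprMn (conj_freq f).2 mulVf// expr1n.
  by rewrite sumr_const card_ord.
have [z1 cz] := conj_unity_root (isT : (0 < 2 * n.+1)%N) z2n.
(* The summand of index f is the odd power t ^+ (2 f + 1), and t ^+ 2 is an
   N-th root of unity, which is 1 only if i = i'. *)
pose t := Num.conj z ^+ i * z ^+ i'.
have z0 : z != 0 by rewrite -normr_gt0 z1.
transitivity (\sum_(f < n.+1) t * (t ^+ 2) ^+ f).
  apply: eq_bigr => f _; rewrite /freq rmorphXn /= -!exprM ![((2 * f).+1 * _)%N]mulnC.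
  by rewrite !exprM -exprMn -/t exprS exprM.
rewrite -mulr_sumr geometric_sum_unity ?mulr0//.
  rewrite -exprM /t exprMn -!(exprM _ _ (2 * n.+1)) ![(_ * (2 * n.+1))%N]mulnC.
  by rewrite !(exprM _ (2 * n.+1)) -rmorphXn /= z2n rmorph1 !expr1n mulr1.
apply: contra ii' => /eqP t2; have : z ^+ (i' * 2) == z ^+ (i * 2).
  rewrite -[X in _ == X]mulr1 -t2 exprMn -!exprM mulrA -exprMn cz.
  by rewrite divff// expr1n mul1r.
rewrite (eq_prim_root_expr prim_z) ![(_ * 2)%N]mulnC !modn_small ?ltn_pmul2l ?ltn_ord//.
by rewrite eqn_pmul2l// => /eqP/val_inj->.
Qed.

Definition eigen_input (f : nat) (j : 'I_k) : C := \sum_(m < n.+1) l j m * freq f ^+ m.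

Definition word_matrix (s : seq 'I_k) : 'M[C]_n.+1 :=
  \prod_(j <- s) lscirc n.+1 (l j).

Lemma real_word_matrix s i i' : Num.conj (word_matrix s i i') = word_matrix s i i'.
Proof.
rewrite /word_matrix; elim: s i i' => [|j s IH] i i'.
  by rewrite big_nil mxE rmorph_nat.
rewrite big_cons mxE rmorph_sum; apply: eq_bigr => m _ /=.
by rewrite rmorphM /= IH mxE; case: ifP => _; rewrite ?rmorphN /= real_l.
Qed.

Definition last_factor (s : seq 'I_k) (f : nat) : C :=
  if odd (size s) then Num.conj (freq f) else freq f.

(** Each matrix exchanges the geometric vectors of ratio [freq f] and
    [conj (freq f)], so that along a product the eigenvalues alternate with
    their conjugates. *)
Lemma word_matrixE s i i' : n.+1%:R * word_matrix s i i' =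
  \sum_(f < n.+1) Num.conj (freq f) ^+ i *
    alternating_prod (eigen_input f) s * last_factor s f ^+ i'.
Proof.
elim: s i i' => [|j s IH] i i'.
  rewrite /word_matrix big_nil mxE mulrnAr mulr1 -freq_orthogonal.
  by apply: eq_bigr => f _; rewrite mulr1.
(* The word has real entries, so the formula may be conjugated; this brings
   it into the form to which the next letter applies. *)
have IHc m : n.+1%:R * word_matrix s m i' = \sum_(f < n.+1) freq f ^+ m *
    Num.conj (alternating_prod (eigen_input f) s) * last_factor (j :: s) f ^+ i'.
  rewrite -[LHS]conjCK rmorphM /= rmorph_nat real_word_matrix IH rmorph_sum.
  apply: eq_bigr => f _ /=; rewrite !rmorphM !rmorphXn /= conjCK; congr (_ * _ ^+ _).
  by rewrite /last_factor /=; case: (odd _); rewrite /= ?conjCK.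
transitivity (\sum_m lscirc n.+1 (l j) i m * (n.+1%:R * word_matrix s m i')).
  rewrite /word_matrix big_cons [X in _ * X]mxE mulr_sumr.
  by apply: eq_bigr => m _; rewrite mulrCA.
under eq_bigr do rewrite IHc mulr_sumr.
rewrite exchange_big; apply: eq_bigr => f _ /=.
under eq_bigr do rewrite !mulrA.
by rewrite -!mulr_suml lscirc_freq !mulrA.
Qed.

Lemma lscirc_half_commute j1 j2 j3 :
  word_matrix [:: j1; j2; j3] = word_matrix [:: j3; j2; j1].
Proof.
apply/matrixP => i i'; have n0 : n.+1%:R != 0 :> C by rewrite pnatr_eq0.
apply: (mulfI n0); rewrite !word_matrixE; apply: eq_bigr => f _.
congr (_ * _ * _); rewrite /= !rmorph1 !mulr1 !rmorphM /= !conjCK.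
ring.
Qed.

(** The normalized sum of the entries omega^(-2 i) for odd words, and of the
    constant 1 for even words. *)
Definition trace_weight (s : seq 'I_k) (f : nat) : C :=
  if odd (size s) then (freq f ^+ 2 == 1)%:R else 1.

Lemma mxtrace_word s : \tr (word_matrix s) =
  \sum_(f < n.+1) trace_weight s f * alternating_prod (eigen_input f) s.
Proof.
have n0 : n.+1%:R != 0 :> C by rewrite pnatr_eq0.
apply: (mulfI n0); rewrite mulr_sumr; under eq_bigr do rewrite word_matrixE.
rewrite exchange_big mulr_sumr; apply: eq_bigr => f _ /=.
under eq_bigr do rewrite mulrAC.
rewrite -mulr_suml mulrA; congr (_ * _).
rewrite /last_factor /trace_weight; case: (odd _); last first.
  under eq_bigr do rewrite -exprMn (conj_freq f).2 mulVf// expr1n.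
  by rewrite sumr_const card_ord mulr1.
under eq_bigr do rewrite -exprD addnn -mul2n exprM -rmorphXn -rmorphXn /=.
case: eqP => [->|/eqP f1].
  under eq_bigr do rewrite expr1n rmorph1.
  by rewrite sumr_const card_ord mulr1.
rewrite -rmorph_sum /= geometric_sum_unity ?rmorph0 ?mulr0//.
by rewrite -exprM mulnC exprM freqXn sqrrN expr1n.
Qed.

Lemma freq_sqr_neq1 f : (f < n.+1)%N -> (2 * f).+1 != n.+1 -> freq f ^+ 2 != 1.
Proof.
move=> fn; apply: contra; rewrite /freq -exprM -(prim_order_dvd prim_z) [((2 * f).+1 * 2)%N]mulnC dvdn_pmul2l//.
move=> /dvdnP[[|[|c]] e]; first by []; first by rewrite e mul1n.
by have := e; lia.
Qed.

Lemma sum_freq_sqr f : freq f ^+ 2 != 1 -> \sum_(m < n.+1) (freq f ^+ 2) ^+ m = 0.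
Proof.
apply: geometric_sum_unity.
by rewrite -exprM mulnC exprM freqXn sqrrN expr1n.
Qed.
End skew_circulant_words.

(** * Convergence of the moments of random words *)

Lemma norm_real_complex (R : realType) (x : R) : `|x%:C| = `|x|%:C.
Proof. by rewrite normc_def /= expr0n addr0 sqrtr_sqr. Qed.

Lemma parity_count_sum k (s : seq 'I_k) :
  (\sum_j (parity_count true s j + parity_count false s j) = size s)%N.
Proof.
elim: s => [|i s IH] /=; first by rewrite big1.
transitivity (\sum_j ((i == j) + (parity_count true s j + parity_count false s j)))%N.
  by apply: eq_bigr => j _; rewrite add0n -addnA [(parity_count false _ _ + _)%N]addnC.
rewrite big_split /= IH (bigD1 i) //= eqxx big1 ?addn0 ?add1n// => j ji.
by rewrite eq_sym (negbTE ji).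
Qed.

Lemma parity_count_le_size k (s : seq 'I_k) j :
  (parity_count true s j + parity_count false s j <= size s)%N.
Proof. by rewrite -parity_count_sum (bigD1 j) //= leq_addr. Qed.

Lemma rayleigh_word_odd (C : numClosedFieldType) k (s : seq 'I_k) :
  odd (size s) -> rayleigh_word C s = 0.
Proof.
move=> os; apply: rayleigh_word_eq0 => sym; move: os.
rewrite -parity_count_sum.
under eq_bigr => j _ do rewrite -!occurrences_atE sym addnn -mul2n.
by rewrite -big_distrr /= mul2n odd_double.
Qed.

Section products_close.
Variables (C : numClosedFieldType) (I : Type).

Lemma norm_prod_le (r : seq I) (x : I -> C) (K : C) :
  (forall i, `|x i| <= K) -> `|\prod_(i <- r) x i| <= K ^+ size r.
Proof.
move=> xK; elim: r => [|i r IH]; first by rewrite big_nil normr1.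
by rewrite big_cons normrM exprS ler_pM.
Qed.

Lemma prod_close (r : seq I) (x y : I -> C) (K e : C) : 1 <= K ->
  (forall i, `|x i| <= K) -> (forall i, `|y i| <= K) ->
  (forall i, `|x i - y i| <= e) ->
  `|\prod_(i <- r) x i - \prod_(i <- r) y i| <= (size r)%:R * K ^+ size r * e.
Proof.
move=> K1 xK yK xy; have K0 : 0 <= K by apply: le_trans K1.
elim: r => [|i r IH]; first by rewrite !big_nil subrr normr0 !mul0r.
have e0 : 0 <= e by apply: le_trans (xy i).
rewrite !big_cons.
have -> : x i * \prod_(j <- r) x j - y i * \prod_(j <- r) y j =
  x i * (\prod_(j <- r) x j - \prod_(j <- r) y j) + (x i - y i) * \prod_(j <- r) y j by ring.
apply: (le_trans (ler_normD _ _)); rewrite !normrM.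
have -> : (size (i :: r))%:R * K ^+ size (i :: r) * e =
  K * ((size r)%:R * K ^+ size r * e) + K ^+ (size r).+1 * e.
  by rewrite /= exprS -natr1; ring.
apply: lerD; first exact: ler_pM.
rewrite mulrC; apply: ler_pM => //.
apply: (le_trans (norm_prod_le r yK)).
by rewrite exprS -[leLHS]mul1r ler_wpM2r// exprn_ge0.
Qed.
End products_close.

Section standard_inputs.
Context d (T : measurableType d) (R : realType) (P : probability T R).
Variable l : nat -> {RV P >-> R}.
Hypothesis mean_l : forall i, ('E_P[l i] = 0)%E.
Hypothesis variance_l : forall i, ('V_P[l i] = 1)%E.
Hypothesis bounded_l : uniformly_bounded_moments P l.

Lemma moment_real i a : moment l i a = (fine 'E_P[fun t => l i t ^+ a])%:C.
Proof.
rewrite /moment; under eq_fun do rewrite -rmorphXn.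
by rewrite cexpectation_real unlock.
Qed.

Lemma standard_moments_input : exists2 b : nat -> R[i], (forall a, 0 <= b a) &
  standard_moments b (moment l).
Proof.
have [b bP] := choice bounded_l.
exists (fun a => `|b a|%:C); first by move=> a; rewrite ler0c.
split=> [i|i|i|i a].
- exact: moment0.
- rewrite moment_real (_ : (fun t => l i t ^+ 1) = l i) ?mean_l//.
- have var1 := variance_l i; rewrite /variance covariance.unlock mean_l /= in var1.
  rewrite moment_real; congr (_%:C); rewrite -[RHS]/(fine 1%E) -var1.
  by congr (fine 'E_P[_]); apply/funext => t; rewrite -[RHS]/((l i t - 0) * (l i t - 0)) subr0 expr2.
have iX : P.-integrable setT (fun t => (l i t ^+ a)%:E).
  have [+ _] := finite_moments_integrable (finite_momentsX a (finite_moments_input bounded_l i)).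
  by apply: eq_integrable => // t _; rewrite -rmorphXn.
rewrite /moment; under eq_fun do rewrite -rmorphXn.
rewrite cexpectation_real norm_real_complex lecR.
apply: (le_trans (le_normr_Rintegral measurableT iX)).
apply: le_trans (ler_norm _); have := bP a i.
rewrite unlock; under eq_integral do rewrite -normrX.
rewrite -lee_fin /Rintegral fineK//.
by apply: integrable_fin_num => //; exact: integrable_abse iX.
Qed.

Lemma moment_system_input (independent_l : independent_RVs P l) w :
  moment_system w (moment l) (form_moment l w).
Proof.
split.
- by move=> s; exact: form_moment0.
- by move=> s p q; exact: form_momentC.
- by move=> s m p q; exact: form_moment_remove.
- by move=> s p q; exact: form_momentS.
Qed.
End standard_inputs.

Section complex_measurability.
Context d (T : measurableType d) (R : realType).
Implicit Types X Y : T -> R[i].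

Definition complex_measurable X :=
  measurable_fun setT (fun t => complex.Re (X t)) /\
  measurable_fun setT (fun t => complex.Im (X t)).

Lemma complex_measurable_cst c : complex_measurable (fun=> c).
Proof. by split; exact: measurable_cst. Qed.

Lemma complex_measurable_real (f : T -> R) :
  measurable_fun setT f -> complex_measurable (fun t => (f t)%:C).
Proof. by split => //=; exact: measurable_cst. Qed.

Lemma complex_measurableD X Y : complex_measurable X -> complex_measurable Y ->
  complex_measurable (fun t => X t + Y t).
Proof.
move=> [xr xi] [yr yi]; split.
  apply: eq_measurable_fun (measurable_funD xr yr) => t _ /=.
  by case: (X t) (Y t) => [? ?] [? ?].
apply: eq_measurable_fun (measurable_funD xi yi) => t _ /=.
by case: (X t) (Y t) => [? ?] [? ?].
Qed.

Lemma complex_measurableM X Y : complex_measurable X -> complex_measurable Y ->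
  complex_measurable (fun t => X t * Y t).
Proof.
move=> [xr xi] [yr yi]; split.
  apply: eq_measurable_fun (measurable_funB (measurable_funM xr yr) (measurable_funM xi yi)).
  by move=> t _ /=; case: (X t) (Y t) => [? ?] [? ?].
apply: eq_measurable_fun (measurable_funD (measurable_funM xr yi) (measurable_funM xi yr)).
by move=> t _ /=; case: (X t) (Y t) => [? ?] [? ?].
Qed.

Lemma complex_measurable_conj X :
  complex_measurable X -> complex_measurable (fun t => Num.conj (X t)).
Proof.
move=> [xr xi]; split.
  by apply: eq_measurable_fun xr => t _ /=; case: (X t).
apply: (eq_measurable_fun (fun t => - complex.Im (X t))).
  by move=> t _ /=; case: (X t).
exact: measurableT_comp.
Qed.

Lemma complex_measurableX X a :
  complex_measurable X -> complex_measurable (fun t => X t ^+ a).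
Proof.
move=> mX; elim: a => [|a IH].
  by under eq_fun do rewrite expr0; exact: complex_measurable_cst.
by under eq_fun do rewrite exprS; exact: complex_measurableM.
Qed.

Lemma complex_measurable_sum (I : eqType) (s : seq I) (F : I -> T -> R[i]) :
  (forall i, i \in s -> complex_measurable (F i)) ->
  complex_measurable (fun t => \sum_(i <- s) F i t).
Proof.
elim: s => [|i s IH] mF.
  by under eq_fun do rewrite big_nil; exact: complex_measurable_cst.
under eq_fun do rewrite big_cons; apply: complex_measurableD.
  by apply: mF; rewrite mem_head.
by apply: IH => j js; apply: mF; rewrite inE js orbT.
Qed.
End complex_measurability.

Section random_lscirc_forms.
Context d (T : measurableType d) (R : realType) (P : probability T R).

Lemma sigma_random_lscirc_measurable (l : nat -> {RV P >-> R}) n A :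
  sigma_random_matrix (random_lscirc l n) A -> measurable A.
Proof.
apply: smallest_sub; first exact: sigma_algebra_measurable.
move=> B [[i j] _] [D mD <-].
have mX : measurable_fun setT (fun w => random_lscirc l n w i j).
  under eq_fun do rewrite mxE.
  case: (i + j < n)%N; first exact: measurable_funPT.
  by apply: measurableT_comp => //; exact: measurable_funPT.
exact: mX.
Qed.

(** The first row of the matrix displays all its inputs. *)
Lemma sigma_random_lscirc_input (l : nat -> {RV P >-> R}) n m : (m < n.+1)%N ->
  let G := \bigcup_(ij in [set: 'I_n.+1 * 'I_n.+1])
        g_sigma_algebra_preimage (fun w => random_lscirc l n.+1 w ij.1 ij.2) in
  measurable_fun (T := g_sigma_algebraType G) setT (l m).
Proof.
move=> mn G _ B mB; apply: sub_gen_smallest.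
exists (ord0, Ordinal mn) => //; exists B => //.
by rewrite !setTI; apply/seteqP; split => w /=; rewrite mxE /= add0n mn.
Qed.

Lemma adapted_form (l : nat -> {RV P >-> R}) n w p q :
  adapted (sigma_random_matrix (random_lscirc l n.+1))
    (fun t => linear_form l w (iota 0 n.+1) t ^+ p *
       Num.conj (linear_form l w (iota 0 n.+1) t) ^+ q).
Proof.
set X := fun t => _.
pose G := \bigcup_(ij in [set: 'I_n.+1 * 'I_n.+1])
        g_sigma_algebra_preimage (fun w => random_lscirc l n.+1 w ij.1 ij.2).
have mS : complex_measurable (T := g_sigma_algebraType G) (linear_form l w (iota 0 n.+1)).
  apply: (@complex_measurable_sum _ (g_sigma_algebraType G) R _ (iota 0 n.+1)
    (fun m t => w m * (l m t)%:C)) => m; rewrite mem_iota add0n => /= mn.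
  apply: complex_measurableM; first exact: complex_measurable_cst.
  by apply: complex_measurable_real; exact: sigma_random_lscirc_input.
have [mr mi] : complex_measurable (T := g_sigma_algebraType G) X.
  apply: complex_measurableM; apply: complex_measurableX => //.
  exact: complex_measurable_conj.
move=> B mB; split; first by have := mr measurableT B mB; rewrite setTI.
by have := mi measurableT B mB; rewrite setTI.
Qed.

Variables (k : nat) (l : 'I_k -> nat -> {RV P >-> R}).
Hypothesis bounded_l : forall j, uniformly_bounded_moments P (l j).
Hypothesis independent_L : forall n,
  independent_random_matrices P (fun j : 'I_k => random_lscirc (l j) n).

Lemma cexpectation_alternating_prod n w s :
  cexpectation P (fun t => alternating_prod (fun j => linear_form (l j) w (iota 0 n.+1) t) s) =
  \prod_j form_moment (l j) w (iota 0 n.+1) (parity_count true s j) (parity_count false s j).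
Proof.
under eq_fun do rewrite alternating_prodE.
rewrite (cexpectation_prod_independent
   (F := fun j => sigma_random_matrix (random_lscirc (l j) n.+1))) //.
- by move=> j A; exact: sigma_random_lscirc_measurable.
- exact: independent_L.
- by move=> j; exact: (finite_moments_form (bounded_l j)).
- by move=> j; exact: (@adapted_form (l j)).
- exact: index_enum_uniq.
Qed.

Definition scaling (n : nat) : R[i] := ((Num.sqrt (n.+1%:R : R))^-1)%:C.

Lemma scaling_ge0 n : 0 <= scaling n.
Proof. by rewrite ler0c invr_ge0 sqrtr_ge0. Qed.

Lemma scaling_sqr n : n.+1%:R * scaling n ^+ 2 = 1.
Proof.
rewrite /scaling -rmorphXn /= exprVn sqr_sqrtr ?ler0n//.
by rewrite -[n.+1%:R in LHS](rmorph_nat (real_complex R)) -rmorphM /= divff.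
Qed.

Lemma scaling_le1 n : scaling n <= 1.
Proof.
rewrite -[1]/(1%:C) lecR invf_le1 ?sqrtr_gt0 ?ltr0Sn//.
by rewrite -[leLHS]sqrtr1 ler_sqrt ?ler1n.
Qed.

Lemma scaling_cvg0 (Q e : R[i]) : 0 <= Q -> 0 < e ->
  \forall n \near \oo, Q * scaling n <= e.
Proof.
move=> Q0 e0.
have QE : Q = (complex.Re Q)%:C by rewrite {1}[Q]complexE ger0_Im// mulr0 addr0.
have eE : e = (complex.Re e)%:C by rewrite {1}[e]complexE ger0_Im ?ltW// mulr0 addr0.
move: Q0 e0; rewrite QE eE; move: (complex.Re Q) (complex.Re e) => {Q e QE eE} q e.
rewrite ler0c (ltcR 0) => q0 e0.
have h0 : q * (Num.sqrt (n.+1%:R : R))^-1 @[n --> \oo] --> q * 0.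
  apply: cvgMl_tmp; rewrite -[0]sqrtr0.
  under eq_fun do rewrite -sqrtrV ?ler0n//.
  by apply: continuous_cvg; [exact: sqrt_continuous|exact: cvg_harmonic].
rewrite mulr0 in h0; near=> n; rewrite /scaling -rmorphM lecR.
by near: n; exact: cvgr_le h0 _ e0.
Unshelve. all: by end_near.
Qed.
End random_lscirc_forms.

Section random_words.
Context d (T : measurableType d) (R : realType) (P : probability T R).
Variables (k : nat) (l : 'I_k -> nat -> {RV P >-> R}).
Hypothesis mean_l : forall j i, ('E_P[l j i] = 0)%E.
Hypothesis variance_l : forall j i, ('V_P[l j i] = 1)%E.
Hypothesis bounded_l : forall j, uniformly_bounded_moments P (l j).
Hypothesis independent_l : forall j, independent_RVs P (l j).
Hypothesis independent_L : forall n,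
  independent_random_matrices P (fun j : 'I_k => random_lscirc (l j) n).

Definition normalized_lscirc n (j : 'I_k) : random_matrix_ncp P n :=
  scaling R n *: lscirc_ncp (bounded_l j) n.

Definition scaled_input n (t : T) (j : 'I_k) (m : nat) : R[i] :=
  scaling R n * (l j m t)%:C.

Lemma conj_scaling n : Num.conj (scaling R n) = scaling R n.
Proof. exact: conj_real_complex. Qed.

Lemma conj_scaled_input n t j m : Num.conj (scaled_input n t j m) = scaled_input n t j m.
Proof. by rewrite rmorphM /= conj_scaling conj_real_complex. Qed.

Lemma normalized_lscircE n j t :
  random_matrix_val (normalized_lscirc n j) t = lscirc n.+1 (scaled_input n t j).
Proof.
rewrite -[LHS]/(scaling R n *: map_mx (real_complex R) (random_lscirc (l j) n.+1 t)).
apply/matrixP => a b; rewrite !mxE.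
by case: ifP => _ //; rewrite rmorphN mulrN.
Qed.

Lemma normalized_wordE n s t :
  random_matrix_val (\prod_(j <- s) normalized_lscirc n j) t =
  word_matrix n (scaled_input n t) s.
Proof.
elim: s => [|j s IH]; first by rewrite /word_matrix !big_nil.
by rewrite /word_matrix !big_cons -[RHS]/(_ *m _) -normalized_lscircE -/(word_matrix _ _ _) -IH.
Qed.

Lemma star_normalized_lscirc n j : star (normalized_lscirc n j) = normalized_lscirc n j.
Proof.
apply: val_inj; apply/funext => t.
rewrite -[LHS]/((map_mx Num.conj (random_matrix_val (normalized_lscirc n j) t))^T).
rewrite -[RHS]/(random_matrix_val (normalized_lscirc n j) t) normalized_lscircE.
apply/matrixP => a b; rewrite !mxE addnC.
by case: ifP => _; rewrite ?rmorphN /= conj_scaled_input.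
Qed.

Lemma half_commute_normalized_lscirc n : half_commute (normalized_lscirc n).
Proof.
have [z prim_z] := prim_root_exists R[i] (isT : (0 < 2 * n.+1)%N).
move=> j1 j2 j3; apply: val_inj; apply/funext => t.
have E i1 i2 i3 : normalized_lscirc n i1 * normalized_lscirc n i2 * normalized_lscirc n i3 =
  \prod_(j <- [:: i1; i2; i3]) normalized_lscirc n j.
  by rewrite !big_cons big_nil mulr1 mulrA.
rewrite !E -[LHS]/(random_matrix_val _ t) -[RHS]/(random_matrix_val _ t) !normalized_wordE.
by apply: (lscirc_half_commute prim_z) => j m; exact: conj_scaled_input.
Qed.

Lemma eigen_input_form n z t f j : eigen_input n z (scaled_input n t) f j =
  linear_form (l j) (fun m => scaling R n * freq z f ^+ m) (iota 0 n.+1) t.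
Proof.
rewrite /eigen_input /linear_form -[iota 0 n.+1]/(index_iota 0 n.+1) big_mkord.
by apply: eq_bigr => m _; rewrite mulrAC.
Qed.

Lemma state_normalized_word n z s : (2 * n.+1).-primitive_root z ->
  ncp_state (random_matrix_ncp P n) (\prod_(j <- s) normalized_lscirc n j) =
  n.+1%:R^-1 * \sum_(f < n.+1) trace_weight z s f *
    \prod_j form_moment (l j) (fun m => scaling R n * freq z f ^+ m) (iota 0 n.+1)
       (parity_count true s j) (parity_count false s j).
Proof.
move=> prim_z.
rewrite -[LHS]/(n.+1%:R^-1 * cexpectation P (fun t =>
  \tr (random_matrix_val (\prod_(j <- s) normalized_lscirc n j) t))); congr (_ * _).
pose S f j := linear_form (l j) (fun m => scaling R n * freq z f ^+ m) (iota 0 n.+1).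
have fmS f : finite_moments P (fun t => alternating_prod (fun j => S f j t) s).
  under eq_fun do rewrite alternating_prodE.
  apply: finite_moments_prod => j.
  exact: (finite_moments_form (bounded_l j)).
transitivity (cexpectation P (fun t => \sum_(f < n.+1) trace_weight z s f *
    alternating_prod (fun j => S f j t) s)).
  congr cexpectation; apply/funext => t; rewrite normalized_wordE (mxtrace_word prim_z).
    by apply: eq_bigr => f _; congr (_ * alternating_prod _ _); apply/funext => j;
       exact: eigen_input_form.
  by move=> j m; exact: conj_scaled_input.
rewrite cexpectation_sum; last first.
  by move=> f; apply: finite_momentsM => //; exact: finite_moments_cst.
apply: eq_bigr => f _; rewrite cexpectationZ//; congr (_ * _).
exact: cexpectation_alternating_prod.
Qed.

(** Each regular frequency contributes an error O(h), and the exceptional one a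
    bounded error of weight h^2 in the average.  In odd words the regular
    frequencies do not contribute at all. *)
Lemma state_normalized_word_close s : exists2 Q : R[i], 0 <= Q & forall n,
  `|ncp_state (random_matrix_ncp P n) (\prod_(j <- s) normalized_lscirc n j)
    - rayleigh_word R[i] s| <= Q * scaling R n.
Proof.
have stdj j := standard_moments_input (mean_l j) (variance_l j) (bounded_l j).
pose bj j := sval (cid2 (stdj j)).
have bj0 j a : 0 <= bj j a by rewrite /bj; case: cid2.
have bjP j : standard_moments (bj j) (moment (l j)) by rewrite /bj; case: cid2.
pose b a := \sum_j bj j a.
have b0 a : 0 <= b a by apply: sumr_ge0 => j _; exact: bj0.
have std j : standard_moments b (moment (l j)).
  case: (bjP j) => m0 m1 m2 m3; split=> // i a; apply: (le_trans (m3 i a)).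
  by rewrite /b (bigD1 j) //= lerDl; apply: sumr_ge0 => j' _; exact: bj0.
have sys j w := moment_system_input (bounded_l j) (@independent_l j) w.
have [K K1 bound] := form_moment_bounded b0 (size s).
have [L L0 gauss] := form_moment_gaussian b0 (size s).
(* A common bound for the moments and for their limits. *)
pose K' := K + ((size s)`!)%:R.
have K0 : 0 <= K by apply: le_trans K1.
have K'1 : 1 <= K' by apply: (le_trans K1); rewrite lerDl.
have K'0 : 0 <= K' by apply: le_trans K'1.
pose N := size (index_enum 'I_k).
pose Q1 := N%:R * K' ^+ N * L; pose Q2 := K' ^+ N + K' ^+ N.
have Q10 : 0 <= Q1 by rewrite !mulr_ge0 ?exprn_ge0.
have Q20 : 0 <= Q2 by rewrite addr_ge0 ?exprn_ge0.
exists (Q1 + Q2); first exact: addr_ge0.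
move=> n; have [z prim_z] := prim_root_exists R[i] (isT : (0 < 2 * n.+1)%N).
have h0 := scaling_ge0 R n; have h1 := scaling_le1 R n; have h2 := scaling_sqr R n.
rewrite (state_normalized_word s prim_z).
set h := scaling R n in h0 h1 h2 *.
pose w (f m : nat) := h * freq z f ^+ m.
have wh f m : `|w f m| = h.
  by rewrite normrM normrX (conj_freq prim_z f).1 expr1n mulr1 ger0_norm.
pose x (f : nat) j := form_moment (l j) (w f) (iota 0 n.+1)
  (parity_count true s j) (parity_count false s j).
pose y j : R[i] := rayleigh_moment R[i] (parity_count true s j) (parity_count false s j).
have sz : (size (iota 0 n.+1))%:R * h ^+ 2 = 1 by rewrite size_iota.
have xK f j : `|x f j| <= K'.
  apply: (@le_trans _ _ K); last by rewrite lerDl.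
  apply: (bound (w f) (moment (l j)) _ h) => //.
  - by rewrite sz.
  - exact: iota_uniq.
  - exact: parity_count_le_size.
have yK j : `|y j| <= K'.
  rewrite /y /rayleigh_moment; case: eqP => _; last by rewrite normr0.
  apply: (@le_trans _ _ ((size s)`!)%:R); last by rewrite /K' lerDr.
  rewrite normr_nat ler_nat; apply: leq_fact.
  by apply: leq_trans (parity_count_le_size s j); exact: leq_addr.
have vE : rayleigh_word R[i] s = \prod_j y j by [].
have v_le : `|rayleigh_word R[i] s| <= K' ^+ N by rewrite vE; exact: norm_prod_le.
pose D (f : nat) := trace_weight z s f * \prod_j x f j.
have D_le f : `|D f| <= K' ^+ N.
  rewrite /D normrM -[leRHS]mul1r; apply: ler_pM => //; last exact: norm_prod_le.
  rewrite /trace_weight; case: ifP => _; last by rewrite normr1.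
  by case: (_ == _); rewrite ?normr1 ?normr0.
have D_close (f : 'I_n.+1) : `|D f - rayleigh_word R[i] s| <=
    Q1 * h + (if (2 * f).+1 == n.+1 then Q2 else 0).
  case: ifP => [_|/negbT fn].
    apply: (le_trans (ler_normB _ _)); apply: (@le_trans _ _ Q2); first exact: lerD.
    by rewrite lerDr mulr_ge0.
  rewrite addr0; have f2 := freq_sqr_neq1 prim_z (ltn_ord f) fn.
  rewrite /D /trace_weight; case: ifP => [os|_].
    by rewrite (negbTE f2) mul0r rayleigh_word_odd// subrr normr0 mulr_ge0.
  rewrite mul1r vE /Q1 -mulrA; apply: prod_close => // j.
  apply: (gauss (w f) (moment (l j)) _ h) => //; first exact: iota_uniq; last first.
    exact: parity_count_le_size.
  rewrite -[iota 0 n.+1]/(index_iota 0 n.+1) big_mkord.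
  under eq_bigr do rewrite /w exprMn -exprM mulnC exprM.
  by rewrite -mulr_sumr (sum_freq_sqr prim_z f2) mulr0.
have n0 : n.+1%:R != 0 :> R[i] by rewrite pnatr_eq0.
have hV : n.+1%:R^-1 = h ^+ 2 by apply: (mulfI n0); rewrite divff// h2.
have -> : n.+1%:R^-1 * (\sum_(f < n.+1) D f) - rayleigh_word R[i] s =
    n.+1%:R^-1 * \sum_(f < n.+1) (D f - rayleigh_word R[i] s).
  rewrite sumrB sumr_const card_ord -[rayleigh_word R[i] s *+ _]mulr_natl mulrBr mulrA.
  by rewrite mulVf// mul1r.
rewrite normrM ger0_norm ?invr_ge0 ?ler0n// hV.
(* 2 f + 1 < 2 N, so N divides 2 f + 1 only if 2 f + 1 = N. *)
have exc : \sum_(f < n.+1) (if (2 * f).+1 == n.+1 then Q2 else 0) <= Q2.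
  have [/existsP[g /eqP gn]|/existsPn none] := boolP [exists g : 'I_n.+1, (2 * g).+1 == n.+1].
    rewrite (bigD1 g) //= gn eqxx big1 ?addr0// => f fg.
    case: eqP => // fn; case/negP: fg; apply/eqP/val_inj => /=.
    by apply/eqP; rewrite -(eqn_pmul2l (isT : (0 < 2)%N)) -eqSS fn gn.
  by rewrite big1// => f _; rewrite (negbTE (none f)).
apply: (@le_trans _ _ (h ^+ 2 * (n.+1%:R * (Q1 * h) + Q2))).
  apply: ler_wpM2l; first exact: exprn_ge0.
  apply: (le_trans (ler_norm_sum _ _ _)); apply: (le_trans (ler_sum _ (fun f _ => D_close f))).
  by rewrite big_split /= sumr_const card_ord -(mulr_natl (Q1 * h)) lerD2l.
have -> : h ^+ 2 * (n.+1%:R * (Q1 * h) + Q2) = Q1 * h * (n.+1%:R * h ^+ 2) + Q2 * h ^+ 2.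
  by ring.
rewrite h2 mulr1 (mulrDl Q1) lerD2l; apply: ler_wpM2l => //.
by rewrite -[leRHS]expr1 ler_wiXn2l.
Qed.

Lemma state_normalized_word_cvg s :
  ncp_state (random_matrix_ncp P n) (\prod_(j <- s) normalized_lscirc n j) @[n --> \oo]
    --> rayleigh_word R[i] s.
Proof.
have [Q Q0 close] := state_normalized_word_close s.
apply/cvgrPdistC_le => e e0; have := scaling_cvg0 Q0 e0.
move=> H; near=> n; apply: (le_trans (close n)).
by near: n; exact: H.
Unshelve. all: by end_near.
Qed.
End random_words.

Theorem theorem3p4 (R : realType) (d : measure_display) (T : measurableType d)
    (P : probability T R) (k : nat) (k_ge1 : (1 <= k)%N)
    (l : 'I_k -> nat -> {RV P >-> R})
    (mean_l : forall j i, ('E_P[l j i] = 0)%E)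
    (variance_l : forall j i, ('V_P[l j i] = 1)%E)
    (bounded_l : forall j, uniformly_bounded_moments P (l j))
    (independent_l : forall j, independent_RVs P (l j))
    (independent_L : forall n,
      independent_random_matrices P (fun j : 'I_k => random_lscirc (l j) n)) :
  exists (A : ncp R[i]) (a : 'I_k -> A),
    [/\ forall j, standard_symmetrized_rayleigh (a j),
        half_independent a &
        converges_in_star_distribution
          (An := fun n => random_matrix_ncp P n)
          (fun n j => ((Num.sqrt (n.+1%:R : R))^-1)%:C *:
                        lscirc_ncp (bounded_l j) n)
          a].
Proof.
have cvg_words := state_normalized_word_cvg mean_l variance_l bounded_l independent_l independent_L.
have [A [a [star_a hc_a state_a]]] := limit_ncp_exists
  (An := fun n => random_matrix_ncp P n) (an := normalized_lscirc bounded_l)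
  (star_normalized_lscirc bounded_l) cvg_words (half_commute_normalized_lscirc bounded_l).
exists A, a; split.
- by move=> j; exact: rayleigh_of_word_moments.
- exact: half_independent_of_word_moments.
move=> [c s]; rewrite -/(normalized_lscirc bounded_l).
(* Adjoints can be dropped from a monomial in self-adjoint variables. *)
have eval (B : ncp R[i]) (b : 'I_k -> B) : (forall j, star (b j) = b j) ->
    ncp_state B (eval_star_monomial b (c, s)) =
    c * ncp_state B (\prod_(j <- [seq x.1 | x <- s]) b j).
  move=> star_b; rewrite /eval_star_monomial linearZ big_map.
  congr (_ * ncp_state _ _); apply: eq_bigr => x _.
  by rewrite star_b if_same.
rewrite (eval A a star_a) state_a.
under eq_fun do rewrite (eval _ _ (star_normalized_lscirc bounded_l _)).
by apply: cvgMl_tmp; exact: cvg_words.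
Qed.
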